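(* Let $\mathbb{F}$ be any field. Up to isomorphism, the nilpotent symplectic alternating algebras over $\mathbb{F}$ of dimension $2n\leq 8$ are as follows. (1) Every nilpotent symplectic alternating algebra of dimension $2$ or $4$ is abelian. (2) In dimension $6$ there is, apart from the abelian algebra, exactly one, given by the presentation $\mathcal{P}_6^{(3,1)}:\ (y_1y_2,y_3)=1$. (3) In dimension $8$ every nilpotent symplectic alternating algebra is either abelian or has exactly one of the following three types of presentations: $$\mathcal{P}_8^{(5,1)}:\ (y_1y_2,y_3)=1;$$ $$\mathcal{P}_8^{(3,2)}:\ (y_1y_2,y_3)=1,\ (x_1y_3,y_4)=1;$$ $$\mathcal{P}_8^{(2,3)}(r):\ (x_2y_3,y_4)=r,\ (x_1y_2,y_4)=1,\ (y_1y_2,y_3)=1,\quad\text{for some } r\in\mathbb{F}^*=\mathbb{F}\setminus\{0\}.$$ Moreover, for $r,s\in\mathbb{F}^*$, $\mathcal{P}_8^{(2,3)}(r)$ and $\mathcal{P}_8^{(2,3)}(s)$ describe the same algebra if and only if $s/r\in(\mathbb{F}^* )^3$.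
   Context: A symplectic alternating algebra (SAA) over a field $\mathbb{F}$ is a finite-dimensional vector space $L$ over $\mathbb{F}$ with a non-degenerate alternating bilinear form $(\ ,\ )$ and a bilinear product $\cdot$ satisfying $u\cdot u=0$ for all $u$ and $(u\cdot v,w)=(v\cdot w,u)$ for all $u,v,w\in L$. No associativity or Jacobi identity is assumed. The map $(u,v,w)\mapsto(uv,w)$ is then an alternating trilinear form. A standard basis is a basis $x_1,y_1,\ldots,x_n,y_n$ with $(x_i,x_j)=(y_i,y_j)=0$ and $(x_i,y_j)=\delta_{ij}$ for all $i,j$. Presentations: $L$ of dimension $2n$ has (is described by) a presentation if there is a standard basis for which the listed values of triples $(uv,w)$ hold and $(uv,w)=0$ for all triples of basis elements that are not a reordering of a listed one. Such data determine a unique SAA of dimension $2n$ up to isomorphism. Two SAA's are the same (isomorphic) if there is a linear bijection between them preserving the product and the alternating form. $L^1=L$, and $L^{m+1}=L^mL$ is the span of all products $uv$ with $u\in L^m,v\in L$. $L$ is nilpotent if $L^{m+1}=\{0\}$ for some $m\geq 0$, and abelian if $L^2=\{0\}$. $(\mathbb{F}^* )^3=\{a^3: a\in\mathbb{F}^*\}$. *)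

(* Defs.v *)
From mathcomp Require Import all_boot all_algebra.

Set Implicit Arguments.
Unset Strict Implicit.
Unset Printing Implicit Defensive.

Import GRing.Theory.

Local Open Scope ring_scope.

(* A vectType is a finite-dimensional vector space.                          *)
Record SAA (F : fieldType) := MkSAA {
  saa_space :> vectType F;
  saa_form : {bilinear saa_space -> saa_space -> F | *%R & *%R};
  saa_mul : {bilinear saa_space -> saa_space -> saa_space};
  saa_form_alternating : forall u, saa_form u u = 0;
  saa_form_nondegenerate : forall u, (forall v, saa_form u v = 0) -> u = 0;
  saa_mul_alternating : forall u, saa_mul u u = 0;
  saa_mul_form : forall u v w,
    saa_form (saa_mul u v) w = saa_form (saa_mul v w) u
}.

Definition saa_dim (F : fieldType) (L : SAA F) : nat := \dim {:L}.

Definition saa_isomorphic (F : fieldType) (L M : SAA F) : Prop :=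
  exists f : 'Hom(L, M),
    [/\ bijective f,
        forall u v, f (saa_mul L u v) = saa_mul M (f u) (f v)
      & forall u v, saa_form M (f u) (f v) = saa_form L u v].

(* As for prodv in falgebra, the span of the products of basis vectors; it   *)
(* is the span of all the products of an element of U by one of V, by        *)
(* saa_prodvP below.                                                         *)
Definition saa_prodv (F : fieldType) (L : SAA F) (U V : {vspace L}) :
  {vspace L} := <<[seq saa_mul L u v | u <- vbasis U, v <- vbasis V]>>%VS.

Lemma saa_memv_prodv (F : fieldType) (L : SAA F) (U V : {vspace L}) :
  {in U & V, forall u v, saa_mul L u v \in saa_prodv U V}.
Proof.
move=> u v /coord_vbasis-> /coord_vbasis->.
rewrite linear_sumlz; apply: memv_suml => i _.
rewrite linear_sumr; apply: memv_suml => j _.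
rewrite linearZl_LR linearZr_LR !memvZ // memv_span //.
by apply/allpairsP; exists ((vbasis U)`_i, (vbasis V)`_j); rewrite !memt_nth.
Qed.

Lemma saa_prodvP (F : fieldType) (L : SAA F) (U V W : {vspace L}) :
  reflect {in U & V, forall u v, saa_mul L u v \in W} (saa_prodv U V <= W)%VS.
Proof.
apply: (iffP idP) => [sUVW u v Uu Vv | UVW].
  by rewrite (subvP sUVW) ?saa_memv_prodv.
apply/span_subvP => _ /allpairsP[[u v] [/vbasis_mem Uu /vbasis_mem Vv ->]].
exact: UVW.
Qed.

(* saa_pow L m is L^m for m >= 1: L^1 = L and L^(m+1) = L^m L. The value at  *)
(* m = 0 is irrelevant.                                                      *)
Definition saa_pow (F : fieldType) (L : SAA F) (m : nat) : {vspace L} :=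
  iter m.-1 (fun U => saa_prodv U fullv) fullv.

Definition saa_nilpotent (F : fieldType) (L : SAA F) : Prop :=
  exists m : nat, saa_pow L m.+1 = 0%VS.

Definition saa_abelian (F : fieldType) (L : SAA F) : Prop :=
  saa_pow L 2 = 0%VS.

(* Names for the 2n elements x_1, ..., x_n, y_1, ..., y_n of a standard      *)
(* basis: inl for the x's, inr for the y's. X i and Y i are numbered from 1  *)
(* (so they are meant for 1 <= i <= n).                                      *)
Definition sgen (n : nat) : finType := ('I_n + 'I_n)%type.
Definition X {n : nat} (i : nat) : sgen n.+1 := inl (inord i.-1).
Definition Y {n : nat} (i : nat) : sgen n.+1 := inr (inord i.-1).

Definition standard_basis (F : fieldType) (L : SAA F) (n : nat)
    (b : sgen n -> L) : Prop :=
  [/\ basis_of {:L} (codom b),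
      forall i j : 'I_n, saa_form L (b (inl i)) (b (inl j)) = 0,
      forall i j : 'I_n, saa_form L (b (inr i)) (b (inr j)) = 0
    & forall i j : 'I_n, saa_form L (b (inl i)) (b (inr j)) = (i == j)%:R].

(* An entry (u, v, w, a) stands for the relation (u v, w) = a.               *)
Definition presentation (F : fieldType) (n : nat) : Type :=
  seq (sgen n * sgen n * sgen n * F).

Definition has_presentation (F : fieldType) (n : nat) (L : SAA F)
    (P : presentation F n) : Prop :=
  exists b : sgen n -> L,
    [/\ standard_basis b,
        forall u v w a, (u, v, w, a) \in P ->
          saa_form L (saa_mul L (b u) (b v)) (b w) = a
      & forall u v w,
          (forall u' v' w' a, (u', v', w', a) \in P ->
             ~~ perm_eq [:: u; v; w] [:: u'; v'; w']) ->
          saa_form L (saa_mul L (b u) (b v)) (b w) = 0].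

Definition P6_31 (F : fieldType) : presentation F 3 :=
  [:: (Y 1, Y 2, Y 3, 1)].

Definition P8_51 (F : fieldType) : presentation F 4 :=
  [:: (Y 1, Y 2, Y 3, 1)].

Definition P8_32 (F : fieldType) : presentation F 4 :=
  [:: (Y 1, Y 2, Y 3, 1); (X 1, Y 3, Y 4, 1)].

Definition P8_23 (F : fieldType) (r : F) : presentation F 4 :=
  [:: (X 2, Y 3, Y 4, r); (X 1, Y 2, Y 4, 1); (Y 1, Y 2, Y 3, 1)].

(* P describes one algebra up to isomorphism, and this algebra is nilpotent  *)
(* and not abelian.                                                          *)
Definition describes_nonabelian_nilpotent (F : fieldType) (n : nat)
    (P : presentation F n) : Prop :=
  [/\ exists L : SAA F, has_presentation L P,
      forall L M : SAA F, has_presentation L P -> has_presentation M P ->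
        saa_isomorphic L M
    & forall L : SAA F, has_presentation L P ->
        saa_nilpotent L /\ ~ saa_abelian L].

Definition exactly_one_of3 (A B C : Prop) : Prop :=
  [\/ [/\ A, ~ B & ~ C], [/\ ~ A, B & ~ C] | [/\ ~ A, ~ B & C]].

(* Main.v *)
Require Import Defs.
From HB Require Import structures.
From mathcomp Require Import all_boot all_algebra.
From mathcomp Require Import ring.

Set Implicit Arguments.
Unset Strict Implicit.
Unset Printing Implicit Defensive.

Import GRing.Theory.

Local Open Scope ring_scope.

(** The product is recovered from the alternating trilinear form
    tri u v w = (uv, w), so an algebra is a symplectic space with an alternating
    trilinear form. Identifying a vector a with the functional (a, -), such a
    form is a trivector: wedge (form a) (form b) (form c) stands for
    a /\ b /\ c. A presentation says that the trivector has a prescribed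
    expression in a standard basis ([has_presentationP]); this gives at once the
    existence of the algebra ([model_has_presentation]) and its uniqueness
    ([saa_isomorphic_of_presentation]).

    A nilpotent algebra of dimension 2n has a Lagrangian flag of ideals
    I_1 < ... < I_n with I_k L contained in I_(k-1): while an isotropic ideal I
    is smaller than its orthogonal, L acts nilpotently on the orthogonal modulo
    I and kills some nonzero class there ([ideal_flag_extend]). Completing the
    flag to a standard basis, tri vanishes on two x's, and tri x_i y_j y_k
    vanishes unless i < j and i < k ([nilpotent_basis]). Nothing is left for
    n <= 2. For n = 3 the trivector is u /\ x2 /\ x3 with u in the plane of
    x1 and y1. For n = 4 it is
      a /\ x3 /\ x4 + x2 /\ w /\ x3 + x2 /\ w' /\ x4
    with a in the span of x1, y1, x2, y2 and w, w' in the plane of x1 and y1.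
    The dimension of the span of w and w' decides: if it is 0 the trivector is
    decomposable or zero ([pencil_rank0]); if it is 1 a shear removes the part
    of a along x2 and w, and what remains of a separates P8_51 from P8_32
    ([pencil_rank1]); if it is 2 a shear leaves only the y2-part of a, whose
    coefficient is the parameter r of P8_23 when nonzero, and gives P8_32 when
    zero ([pencil_rank2]).

    The three types are told apart by the nilpotency class: L^3 = 0 for P8_51,
    L^3 <> 0 = L^4 for P8_32, and L^4 <> 0 for P8_23. The vanishing comes from
    weights on the basis ([saa_pow_weighted]).

    Finally, two standard bases presenting the same algebra as P8_23 r and
    P8_23 s respect the same chain of characteristic subspaces, so their
    matrix is block triangular. If mu is its entry at x2, the blocks on
    y3, y4 and on x1, y1 have determinants mu^2 and 1, and comparing the values
    (x2 y3, y4) gives s = r mu^3 ([P8_23_cube]); the converse is a diagonal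
    change of basis ([P8_23_scale]). *)

(** * Alternating trilinear forms *)

Section AlternatingForms.

Variable F : fieldType.

(** Additivity in the first argument, cyclicity and vanishing on a repeated
    argument imply trilinearity and antisymmetry, in any characteristic. *)
Definition alternating3 (V : vectType F) (f : V -> V -> V -> F) : Prop :=
  [/\ forall a u u' v w, f (a *: u + u') v w = a * f u v w + f u' v w,
      forall u v w, f u v w = f v w u
    & forall u v, f u u v = 0].

(** The 3x3 determinant of a, b, c evaluated at u, v, w. *)
Definition wedge (V : Type) (a b c : V -> F) (u v w : V) : F :=
  a u * (b v * c w - b w * c v) - a v * (b u * c w - b w * c u)
  + a w * (b u * c v - b v * c u).

Lemma linear_span_eq0 (V : vectType F) (f : V -> F) (s : seq V) :
  (forall a u v, f (a *: u + v) = a * f u + f v) ->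
  (forall v, v \in s -> f v = 0) -> {in <<s>>%VS, forall v, f v = 0}.
Proof.
move=> f_lin f_s v /(@coord_span _ _ _ (in_tuple s))->.
have f0 : f 0 = 0.
  by have := f_lin (-1) 0 0; rewrite scaleN1r addr0 oppr0 mulN1r addNr.
apply: (big_ind (fun v => f v = 0)) => // [x y fx fy|i _].
  by rewrite -[x]scale1r f_lin fx fy mulr0 addr0.
by rewrite -[_ *: _]addr0 f_lin f0 f_s ?mem_nth ?mulr0 ?addr0.
Qed.

Lemma alternating3_sum (V : vectType F) (I : Type) (r : seq I) (c : I -> F)
    (f : I -> V -> V -> V -> F) :
  (forall i, alternating3 (f i)) ->
  alternating3 (fun u v w => \sum_(i <- r) c i * f i u v w).
Proof.
move=> alt_f; split=> [a u u' v w|u v w|u v].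
- rewrite mulr_sumr -big_split; apply: eq_bigr => i _.
  by case: (alt_f i) => -> _ _ /=; ring.
- by apply: eq_bigr => i _; case: (alt_f i) => _ -> _.
- by apply: big1 => i _; case: (alt_f i) => _ _ ->; rewrite mulr0.
Qed.

Lemma alternating3_add (V : vectType F) (f g : V -> V -> V -> F) :
  alternating3 f -> alternating3 g ->
  alternating3 (fun u v w => f u v w + g u v w).
Proof.
move=> [f1 f2 f3] [g1 g2 g3]; split=> [a u u' v w|u v w|u v].
- by rewrite f1 g1; ring.
- by rewrite f2 g2.
- by rewrite f3 g3 addr0.
Qed.

Lemma alternating3_wedge (V : vectType F) (a b c : V -> F) :
  (forall k u v, a (k *: u + v) = k * a u + a v) ->
  (forall k u v, b (k *: u + v) = k * b u + b v) ->
  (forall k u v, c (k *: u + v) = k * c u + c v) ->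
  alternating3 (wedge a b c).
Proof.
move=> aE bE cE; split=> [k u u' v w|u v w|u v]; rewrite /wedge ?aE ?bE ?cE.
all: ring.
Qed.

Section Theory.

Variables (V : vectType F) (f : V -> V -> V -> F).
Hypothesis f_alt : alternating3 f.

Lemma alt3_cycle u v w : f u v w = f v w u.
Proof. by case: f_alt. Qed.

Lemma alt3_eq0l u v : f u u v = 0.
Proof. by case: f_alt. Qed.

Lemma alt3_eq0r u v : f v u u = 0.
Proof. by rewrite alt3_cycle alt3_eq0l. Qed.

Lemma alt3_eq0m u v : f u v u = 0.
Proof. by rewrite -alt3_cycle alt3_eq0l. Qed.

Lemma alt3_linear1 v w a u u' : f (a *: u + u') v w = a * f u v w + f u' v w.
Proof. by case: f_alt. Qed.

Lemma alt3_linear2 u w a v v' : f u (a *: v + v') w = a * f u v w + f u v' w.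
Proof. by rewrite !(alt3_cycle u) alt3_linear1. Qed.

Lemma alt3_linear3 u v a w w' : f u v (a *: w + w') = a * f u v w + f u v w'.
Proof. by rewrite -!(alt3_cycle _ u v) alt3_linear1. Qed.

Lemma alt3_swap u v w : f v u w = - f u v w.
Proof.
have := alt3_eq0l (1 *: u + v) w.
rewrite alt3_linear1 !alt3_linear2 !alt3_eq0l !mul1r add0r addr0.
by move/eqP; rewrite addrC addr_eq0 => /eqP.
Qed.

End Theory.

Lemma alt3_basis_eq (V : vectType F) (I : finType) (b : I -> V)
    (f g : V -> V -> V -> F) :
  alternating3 f -> alternating3 g -> basis_of fullv (codom b) ->
  (forall i j k, f (b i) (b j) (b k) = g (b i) (b j) (b k)) ->
  forall u v w, f u v w = g u v w.
Proof.
move=> alt_f alt_g b_basis fg_b.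
have in_b v : v \in <<codom b>>%VS by rewrite (span_basis b_basis) memvf.
suff fg0 u v w : f u v w - g u v w = 0.
  by move=> u v w; apply/eqP; rewrite -subr_eq0 fg0.
move: (in_b u); move: u; apply: linear_span_eq0 => [a u u'|_ /codomP[i ->]].
  by rewrite (alt3_linear1 alt_f) (alt3_linear1 alt_g); ring.
move: (in_b v); move: v; apply: linear_span_eq0 => [a v v'|_ /codomP[j ->]].
  by rewrite (alt3_linear2 alt_f) (alt3_linear2 alt_g); ring.
move: (in_b w); move: w; apply: linear_span_eq0 => [a w w'|_ /codomP[k ->]].
  by rewrite (alt3_linear3 alt_f) (alt3_linear3 alt_g); ring.
by rewrite fg_b subrr.
Qed.

(** The even permutations come first, then the odd ones. *)
Lemma perm3P (I : eqType) (i j k i' j' k' : I) :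
  perm_eq [:: i; j; k] [:: i'; j'; k'] ->
  (i, j, k) \in [:: (i', j', k'); (j', k', i'); (k', i', j');
                   (j', i', k'); (k', j', i'); (i', k', j')].
Proof.
have perm2P (a b a' b' : I) : perm_eq [:: a; b] [:: a'; b'] ->
    a = a' /\ b = b' \/ a = b' /\ b = a'.
  move=> pab; have := perm_mem pab a; rewrite !inE eqxx /=.
  have perm1 (c c' : I) : perm_eq [:: c] [:: c'] -> c = c'.
    by move/perm_mem/(_ c); rewrite !inE eqxx => /esym/eqP.
  case/esym/orP=> /eqP eq_a; rewrite {}eq_a in pab *.
    by left; split=> //; apply: perm1; rewrite perm_cons in pab.
  right; split=> //; apply: perm1.
  by rewrite perm_sym (perm_catC [:: a'] [:: b']) /= perm_cons perm_sym in pab.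
move=> pijk; have := perm_mem pijk i; rewrite !inE !xpair_eqE eqxx /=.
case/esym/or3P=> /eqP eq_i; rewrite {}eq_i in pijk *.
- move: pijk; rewrite perm_cons => /perm2P[] [-> ->]; rewrite !eqxx ?orbT //.
- move: pijk; rewrite perm_sym (perm_catCA [:: i'] [:: j'] [:: k']) perm_cons.
  by rewrite perm_sym => /perm2P[] [-> ->]; rewrite !eqxx ?orbT.
- move: pijk; rewrite perm_sym (perm_catC [:: i'; j'] [:: k']) perm_cons.
  by rewrite perm_sym => /perm2P[] [-> ->]; rewrite !eqxx ?orbT.
Qed.

(** Both sides change by the same sign, the signature of the permutation, so
    one value for each unordered triple is enough. *)
Lemma alt3_perm_eq (V W : vectType F) (I : eqType) (b : I -> V) (c : I -> W)
    (f : V -> V -> V -> F) (g : W -> W -> W -> F) :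
  alternating3 f -> alternating3 g -> forall i j k i' j' k',
  perm_eq [:: i; j; k] [:: i'; j'; k'] ->
  f (b i') (b j') (b k') = g (c i') (c j') (c k') ->
  f (b i) (b j) (b k) = g (c i) (c j) (c k).
Proof.
move=> alt_f alt_g i j k i' j' k' /perm3P.
have [fC gC] := (alt3_cycle alt_f, alt3_cycle alt_g).
have [fS gS] := (alt3_swap alt_f, alt3_swap alt_g).
rewrite !inE !xpair_eqE.
case/or4P=> [|||/or3P[||]] /andP[/andP[/eqP-> /eqP->] /eqP->] fg_i.
- by [].
- by rewrite -fC -gC.
- by rewrite fC gC.
- by rewrite fS gS fg_i.
- by rewrite fS gS -fC -gC fg_i.
- by rewrite fS gS fC gC fg_i.
Qed.

End AlternatingForms.

(** * The trilinear form of an algebra *)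

Definition form (F : fieldType) (L : SAA F) (u v : L) : F := saa_form L u v.

Definition tri (F : fieldType) (L : SAA F) (u v w : L) : F :=
  form (saa_mul L u v) w.

Section Form.

Variables (F : fieldType) (L : SAA F).
Implicit Types u v w : L.

Lemma formDl u v w : form (u + v) w = form u w + form v w.
Proof. exact: linearDl. Qed.

Lemma formDr u v w : form w (u + v) = form w u + form w v.
Proof. exact: linearDr. Qed.

Lemma formNl u w : form (- u) w = - form u w.
Proof. exact: linearNl. Qed.

Lemma formNr u w : form w (- u) = - form w u.
Proof. exact: linearNr. Qed.

Lemma formZl a u w : form (a *: u) w = a * form u w.
Proof. exact: linearZl_LR. Qed.

Lemma formZr a u w : form w (a *: u) = a * form w u.
Proof. exact: linearZr_LR. Qed.

Lemma form0l w : form 0 w = 0.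
Proof. exact: linear0l. Qed.

Lemma formxx u : form u u = 0.
Proof. exact: saa_form_alternating. Qed.

Lemma form_sym u v : form u v = - form v u.
Proof.
have := formxx (u + v); rewrite formDl !formDr !formxx add0r addr0.
by move/eqP; rewrite addr_eq0 => /eqP.
Qed.

Lemma form_suml (I : Type) (r : seq I) (P : pred I) (f : I -> L) w :
  form (\sum_(i <- r | P i) f i) w = \sum_(i <- r | P i) form (f i) w.
Proof. exact: linear_sumlz. Qed.

Lemma form_sumr (I : Type) (r : seq I) (P : pred I) (f : I -> L) w :
  form w (\sum_(i <- r | P i) f i) = \sum_(i <- r | P i) form w (f i).
Proof. exact: linear_sumr. Qed.

Lemma form_inj u v : (forall w, form u w = form v w) -> u = v.
Proof.
move=> eq_uv; apply/eqP; rewrite -subr_eq0; apply/eqP.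
apply: (saa_form_nondegenerate (s := L)) => w.
by rewrite -/(form _ _) formDl formNl eq_uv subrr.
Qed.

Lemma form_linear_r w a u v : form w (a *: u + v) = a * form w u + form w v.
Proof. by rewrite formDr formZr. Qed.

Lemma alternating3_tri : alternating3 (@tri F L).
Proof.
split=> [a u u' v w|u v w|u v]; rewrite /tri.
- by rewrite -formZl -formDl linearDl linearZl_LR.
- exact: saa_mul_form.
- by rewrite saa_mul_alternating form0l.
Qed.

Lemma alternating3_form_wedge (a b c : L) :
  alternating3 (wedge (form a) (form b) (form c)).
Proof. by apply: alternating3_wedge => k u v; exact: form_linear_r. Qed.

Lemma abelianP : saa_abelian L <-> forall u v w : L, tri u v w = 0.
Proof.
rewrite /saa_abelian /saa_pow /=; split=> [L2 u v w|tri0].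
  rewrite /tri (_ : saa_mul L u v = 0) ?form0l //; apply/eqP.
  by rewrite -memv0 -L2 saa_memv_prodv ?memvf.
apply/eqP; rewrite -subv0; apply/saa_prodvP => u v _ _; rewrite memv0.
by apply/eqP/form_inj => w; rewrite form0l -/(tri u v w) tri0.
Qed.

End Form.

Section StandardBasis.

Variables (F : fieldType) (L : SAA F) (n : nat).
Implicit Types (b : sgen n -> L) (P : presentation F n).

Definition star (k : sgen n) : sgen n :=
  match k with inl i => inr i | inr i => inl i end.

(** The k-th coordinate of u in a standard basis is [form (dual b k) u]. *)
Definition dual b (k : sgen n) : L :=
  match k with inl i => - b (inr i) | inr i => b (inl i) end.

Lemma form_dual b k l : standard_basis b -> form (dual b k) (b l) = (k == l)%:R.
Proof.
case=> _ bxx byy bxy; case: k l => i [] j /=.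
- by rewrite formNl form_sym opprK [LHS]bxy eq_sym.
- by rewrite formNl [form _ _]byy oppr0.
- exact: bxx.
- exact: bxy.
Qed.

Lemma standard_sum b u : standard_basis b ->
  u = \sum_k form (dual b k) u *: b k.
Proof.
move=> b_std; apply: form_inj => w; apply/eqP; rewrite -subr_eq0; apply/eqP.
have b_basis : basis_of fullv (codom b) by case: b_std.
have: u \in <<codom b>>%VS by rewrite (span_basis b_basis) memvf.
move: u; apply: linear_span_eq0 => [a u v|_ /codomP[i ->]].
  rewrite formDl formZl mulrDr mulrN !form_suml addrACA -opprD; congr (_ - _).
  rewrite mulr_sumr -big_split; apply: eq_bigr => k _ /=.
  by rewrite !formZl formDr formZr mulrDl mulrA.
rewrite (bigD1 i) //= form_dual // eqxx scale1r big1 ?addr0 ?subrr // => k ki.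
by rewrite form_dual // (negPf ki) scale0r.
Qed.

Definition triple (T : Type) (e : T * T * T * F) : seq T :=
  [:: e.1.1.1; e.1.1.2; e.1.2].

(** The entry (u v, w) = a contributes a times the product of the coordinate
    functionals of u, v and w. *)
Definition presentation_form b P (u v w : L) : F :=
  \sum_(e <- P) e.2 * wedge (form (dual b e.1.1.1)) (form (dual b e.1.1.2))
                            (form (dual b e.1.2)) u v w.

(** Without these conditions an entry with a repeated element, or two entries
    on the same elements, could contradict each other. *)
Definition coherent P : bool :=
  all (fun e => uniq (triple e)) P
  && pairwise (fun e f => ~~ perm_eq (triple e) (triple f)) P.

Lemma alternating3_presentation b P : alternating3 (presentation_form b P).
Proof. by apply: alternating3_sum => e; exact: alternating3_form_wedge. Qed.

Lemma wedge_dual_eq1 b i j k : standard_basis b -> uniq [:: i; j; k] ->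
  wedge (form (dual b i)) (form (dual b j)) (form (dual b k)) (b i) (b j) (b k)
    = 1.
Proof.
move=> b_std; rewrite /= !inE negb_or andbT => /andP[/andP[ij ik] jk].
rewrite /wedge !form_dual // !eqxx (negPf ij) (negPf ik) (negPf jk).
by rewrite ![k == _]eq_sym ![j == i]eq_sym (negPf ij) (negPf ik) (negPf jk) /=; ring.
Qed.

(** Each of the six terms of the determinant is the indicator of one of the
    six bijections between the two triples. *)
Lemma wedge_dual_eq0 b i j k i' j' k' : standard_basis b ->
  ~~ perm_eq [:: i'; j'; k'] [:: i; j; k] ->
  wedge (form (dual b i)) (form (dual b j)) (form (dual b k))
    (b i') (b j') (b k') = 0.
Proof.
move=> b_std nperm; rewrite /wedge !form_dual //.
have term0 p q r : (forall x, count x [:: p; q; r] = count x [:: i; j; k]) ->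
    (p == i')%:R * (q == j')%:R * (r == k')%:R = 0 :> F.
  move=> /permP; case: (p =P i') => [->|_ _]; last by rewrite !mul0r.
  case: (q =P j') => [->|_ _]; last by rewrite mulr0 mul0r.
  case: (r =P k') => [->|_ _]; last by rewrite mulr0.
  by rewrite (negPf nperm).
have t1 := term0 i j k (fun=> erefl).
have t2 := term0 i k j ltac:(move=> x /=; ring).
have t3 := term0 j i k ltac:(move=> x /=; ring).
have t4 := term0 j k i ltac:(move=> x /=; ring).
have t5 := term0 k i j ltac:(move=> x /=; ring).
have t6 := term0 k j i ltac:(move=> x /=; ring).
move: t1 t2 t3 t4 t5 t6 {term0}.
move: (i == i')%:R (i == j')%:R (i == k')%:R (j == i')%:R (j == j')%:R.
move: (j == k')%:R (k == i')%:R (k == j')%:R (k == k')%:R.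
move=> x1 x2 x3 x4 x5 x6 x7 x8 x9 t1 t2 t3 t4 t5 t6.
rewrite -[RHS](_ : x5 * x9 * x4 - x5 * x3 * x1 - x8 * x6 * x4 + x2 * x6 * x1
  + x8 * x3 * x7 - x2 * x9 * x7 = 0); first by ring.
by rewrite t1 t2 t3 t4 t5 t6 !subr0 !addr0.
Qed.

Lemma presentation_form_entry b P e : standard_basis b -> coherent P -> e \in P ->
  presentation_form b P (b e.1.1.1) (b e.1.1.2) (b e.1.2) = e.2.
Proof.
move=> b_std; rewrite /presentation_form.
elim: P => // f P IH /andP[/= /andP[f_uniq P_uniq] /andP[/allP fP P_pair]].
rewrite big_cons inE; case: eqVneq => [-> _|_ /= eP].
  rewrite wedge_dual_eq1 // mulr1 big_seq big1 ?addr0 // => g gP.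
  by rewrite wedge_dual_eq0 ?mulr0 //; exact: fP.
rewrite wedge_dual_eq0 // ?mulr0 ?add0r; last by rewrite perm_sym; exact: fP.
by rewrite IH // /coherent P_uniq.
Qed.

Lemma presentation_form_eq0 b P i j k : standard_basis b ->
  (forall e, e \in P -> ~~ perm_eq [:: i; j; k] (triple e)) ->
  presentation_form b P (b i) (b j) (b k) = 0.
Proof.
move=> b_std nperm; rewrite /presentation_form big_seq big1 // => e eP.
by rewrite wedge_dual_eq0 ?mulr0 //; exact: nperm.
Qed.

(** The conditions on basis elements in a presentation amount to one identity
    between alternating forms, which no longer refers to the basis elements one
    by one: changing the basis becomes a polynomial identity in coordinates. *)
Lemma has_presentationP P : coherent P ->
  has_presentation L P <-> exists b, standard_basis b /\
    forall u v w, tri u v w = presentation_form b P u v w.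
Proof.
move=> P_coh; split=> [[b [b_std b_eq b_eq0]]|[b [b_std triE]]]; exists b.
  split=> //; have b_basis : basis_of fullv (codom b) by case: b_std.
  have alt_t := alternating3_tri L; have alt_P := alternating3_presentation b P.
  apply: (alt3_basis_eq alt_t alt_P b_basis) => i j k.
  have [/hasP[e eP ijk]|] := boolP (has (fun e => perm_eq [:: i; j; k] (triple e)) P).
    apply: (alt3_perm_eq alt_t alt_P ijk).
    rewrite presentation_form_entry //.
    by case: e eP {ijk} => [[[u v] w] a] /b_eq.
  move/hasPn => nperm; rewrite presentation_form_eq0 //.
  by apply: b_eq0 => u v w a /nperm.
split=> // [u v w a eP|u v w nperm].
  rewrite -/(form _ _) -/(tri _ _ _) triE.
  exact: (presentation_form_entry b_std P_coh eP).
rewrite -/(form _ _) -/(tri _ _ _) triE presentation_form_eq0 //.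
by move=> [[[u' v'] w'] a]; exact: nperm.
Qed.

End StandardBasis.

(** * Existence and uniqueness of the algebra with a given presentation *)

Lemma free_dual (F : fieldType) (V : vectType F) (I : finType) (b : I -> V)
    (d : I -> V -> F) :
  (forall k a u v, d k (a *: u + v) = a * d k u + d k v) ->
  (forall k l, d k (b l) = (k == l)%:R) -> free (codom b).
Proof.
move=> d_lin d_b; apply/(@freeP _ _ _ (codom_tuple b)) => a /= sum0 i.
have d0 k : d k 0 = 0.
  by have := d_lin k (-1) 0 0; rewrite scaler0 addr0 mulN1r addNr.
have d_sum k (r : seq 'I_#|I|) : d k (\sum_(j <- r) a j *: (codom b)`_j)
    = \sum_(j <- r) a j * d k (codom b)`_j.
  by elim: r => [|j r IH]; rewrite ?big_nil ?big_cons ?d_lin ?IH.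
have nth_b (j : 'I_#|I|) : (codom b)`_j = b (enum_val j).
  by rewrite codomE (nth_map (enum_default j)) -?cardE // (enum_val_nth (enum_default j)).
have := d_sum (enum_val i) (index_enum _); rewrite sum0 d0 (bigD1 i) //=.
rewrite nth_b d_b eqxx mulr1 big1 ?addr0 // => j ji.
by rewrite nth_b d_b (inj_eq enum_val_inj) eq_sym (negPf ji) mulr0.
Qed.

Section Model.

Variables (F : fieldType) (n : nat) (P : presentation F n).

(** The model is the space of coordinate vectors with the standard symplectic
    form; its product is defined so that (uv, w) is the prescribed trilinear
    form. *)
Definition model : vectType F := {ffun sgen n -> F^o}.

Definition entry (k : sgen n) (u : model) : F := (u : {ffun sgen n -> F^o}) k.

Definition unit_vector (k : sgen n) : model :=
  [ffun l => (k == l)%:R : F] : {ffun sgen n -> F^o}.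

Definition model_form (u v : model) : F :=
  \sum_i (entry (inl i) u * entry (inr i) v - entry (inr i) u * entry (inl i) v).

Definition model_tri (u v w : model) : F :=
  \sum_(e <- P)
    e.2 * wedge (entry e.1.1.1) (entry e.1.1.2) (entry e.1.2) u v w.

Definition model_mul (u v : model) : model :=
  [ffun k => match k with
             | inl i => model_tri u v (unit_vector (inr i))
             | inr i => - model_tri u v (unit_vector (inl i))
             end] : {ffun sgen n -> F^o}.

Lemma entry_linear k a u v : entry k (a *: u + v) = a * entry k u + entry k v.
Proof. by rewrite /entry !ffunE. Qed.

Lemma entry_unit k l : entry k (unit_vector l) = (l == k)%:R.
Proof. by rewrite /entry ffunE. Qed.

Lemma entry_inj u v : (forall k, entry k u = entry k v) -> u = v.
Proof. by move=> uv; apply/ffunP. Qed.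

Lemma alternating3_model_tri : alternating3 model_tri.
Proof.
by apply: alternating3_sum => e; apply: alternating3_wedge => k u v;
  exact: entry_linear.
Qed.

Lemma model_form_bilinear : bilinear_for *%R *%R model_form.
Proof.
split=> [v a u u'|u a v v']; rewrite /= /model_form mulr_sumr -big_split.
all: by apply: eq_bigr => i _; rewrite !entry_linear /=; ring.
Qed.

HB.instance Definition _ :=
  bilinear_isBilinear.Build F model model F *%R *%R model_form model_form_bilinear.

Lemma model_mul_bilinear : bilinear_for *:%R *:%R model_mul.
Proof.
have alt := alternating3_model_tri.
split=> [v a u u'|u a v v']; apply: entry_inj => -[] i /=.
all: rewrite entry_linear /entry !ffunE.
- exact: (alt3_linear1 alt).
- by rewrite (alt3_linear1 alt) opprD -mulrN.
- exact: (alt3_linear2 alt).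
- by rewrite (alt3_linear2 alt) opprD -mulrN.
Qed.

HB.instance Definition _ :=
  bilinear_isBilinear.Build F model model model *:%R *:%R
    model_mul model_mul_bilinear.

Lemma model_form_unit k u : model_form (unit_vector k) u =
  match k with inl i => entry (inr i) u | inr i => - entry (inl i) u end.
Proof.
rewrite /model_form; case: k => i; rewrite (bigD1 i) //= big1 ?addr0 => [|j ji].
- by rewrite !entry_unit eqxx mul1r mul0r subr0.
- by rewrite !entry_unit /eq_op /= eq_sym (negPf ji) !mul0r subr0.
- by rewrite !entry_unit eqxx mul1r mul0r sub0r.
- by rewrite !entry_unit /eq_op /= eq_sym (negPf ji) !mul0r subr0.
Qed.

Lemma model_form_alternating u : model_form u u = 0.
Proof. by apply: big1 => i _; rewrite mulrC subrr. Qed.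

Lemma model_form_nondegenerate u : (forall v, model_form u v = 0) -> u = 0.
Proof.
move=> u0; have u0' v : model_form v u = 0.
  rewrite -[RHS]oppr0 -(u0 v) /model_form -sumrN.
  by apply: eq_bigr => i _; ring.
apply: entry_inj => k; rewrite [RHS]ffunE.
case: k => i; last by rewrite -(u0' (unit_vector (inl i))) model_form_unit.
by apply: oppr_inj; rewrite oppr0 -(u0' (unit_vector (inr i))) model_form_unit.
Qed.

Lemma model_sum u : u = \sum_k entry k u *: unit_vector k.
Proof.
apply: entry_inj => l; rewrite {2}/entry sum_ffunE (bigD1 l) //= big1 ?addr0.
  by rewrite !ffunE eqxx [_ *: _]mulr1.
by move=> k kl; rewrite !ffunE (negPf kl) [_ *: _]mulr0.
Qed.

Lemma model_mul_form u v w : model_form (model_mul u v) w = model_tri u v w.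
Proof.
have alt := alternating3_model_tri.
have tri0 : model_tri u v 0 = 0.
  have := alt3_linear3 alt u v (-1) 0 0.
  by rewrite scaler0 addr0 mulN1r addNr.
have tri_sum (r : seq (sgen n)) :
    model_tri u v (\sum_(k <- r) entry k w *: unit_vector k)
    = \sum_(k <- r) entry k w * model_tri u v (unit_vector k).
  elim: r => [|k r IH]; first by rewrite !big_nil.
  by rewrite !big_cons (alt3_linear3 alt) IH.
rewrite {2}[w]model_sum tri_sum big_sumType /= -big_split.
apply: eq_bigr => i _; rewrite {1 3}/entry !ffunE /=; ring.
Qed.

Lemma model_cycle u v w :
  model_form (model_mul u v) w = model_form (model_mul v w) u.
Proof. by rewrite !model_mul_form (alt3_cycle alternating3_model_tri). Qed.

Lemma model_mul_alternating u : model_mul u u = 0.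
Proof.
apply: model_form_nondegenerate => v.
by rewrite model_mul_form (alt3_eq0l alternating3_model_tri).
Qed.

Definition model_saa : SAA F :=
  @MkSAA F model model_form model_mul model_form_alternating
    model_form_nondegenerate model_mul_alternating model_cycle.

Lemma model_standard : standard_basis (unit_vector : sgen n -> model_saa).
Proof.
split=> [|i j|i j|i j].
- apply/andP; split; last first.
    by apply: (free_dual entry_linear) => k l; rewrite entry_unit eq_sym.
  rewrite eqEsubv subvf; apply/subvP => u _; rewrite [u]model_sum.
  by apply: memv_suml => k _; rewrite memvZ // memv_span // codom_f.
- by rewrite [LHS]model_form_unit entry_unit.
- by rewrite [LHS]model_form_unit entry_unit oppr0.
- by rewrite [LHS]model_form_unit entry_unit /eq_op /= eq_sym.
Qed.

Lemma model_has_presentation : coherent P -> has_presentation model_saa P.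
Proof.
move=> P_coh; apply/has_presentationP => //; exists unit_vector.
split=> [|u v w]; first exact: model_standard.
have dualE k x : form (dual (unit_vector : sgen n -> model_saa) k) x = entry k x.
  case: k => i; first by rewrite formNl [form _ _]model_form_unit opprK.
  exact: model_form_unit.
rewrite [LHS]model_mul_form; apply: eq_bigr => e _.
by rewrite /wedge !dualE.
Qed.

End Model.

Section Isomorphism.

Variables (F : fieldType) (n : nat) (P : presentation F n).
Implicit Types L M : SAA F.

(** The linear map matching the two bases preserves the form and tri, hence,
    the form being nondegenerate, the product. *)
Lemma saa_isomorphic_of_presentation L M : coherent P ->
  has_presentation L P -> has_presentation M P -> saa_isomorphic L M.
Proof.
move=> P_coh /(has_presentationP _ P_coh)[b [b_std triL]].
move=> /(has_presentationP _ P_coh)[c [c_std triM]].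
have b_basis : basis_of fullv (codom b) by case: b_std.
have [_ cxx cyy cxy] := c_std; have [_ bxx byy bxy] := b_std.
pose g u := \sum_k form (dual b k) u *: c k.
pose h u := \sum_k form (dual c k) u *: b k.
have g_dual k u : form (dual c k) (g u) = form (dual b k) u.
  rewrite form_sumr (bigD1 k) //= formZr form_dual // eqxx mulr1.
  by rewrite big1 ?addr0 // => l lk; rewrite formZr form_dual // eq_sym (negPf lk) mulr0.
have h_dual k u : form (dual b k) (h u) = form (dual c k) u.
  rewrite form_sumr (bigD1 k) //= formZr form_dual // eqxx mulr1.
  by rewrite big1 ?addr0 // => l lk; rewrite formZr form_dual // eq_sym (negPf lk) mulr0.
have gK : cancel g h by move=> u; rewrite [RHS](standard_sum u b_std);
  apply: eq_bigr => k _; rewrite g_dual.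
have hK : cancel h g by move=> u; rewrite [RHS](standard_sum u c_std);
  apply: eq_bigr => k _; rewrite h_dual.
have g_lin : linear g.
  move=> a u v; rewrite /g scaler_sumr -big_split; apply: eq_bigr => k _ /=.
  by rewrite formDr formZr scalerDl scalerA.
have form_g u v : form (g u) (g v) = form u v.
  have form_c k w : form (c k) (g w) = form (b k) w.
    case: k => i; last first.
      by have := g_dual (inl i) w; rewrite !formNl => /oppr_inj.
    exact: (g_dual (inr i)).
  rewrite form_suml [in RHS](standard_sum u b_std) form_suml.
  by apply: eq_bigr => k _; rewrite !formZl form_c.
pose gM := GRing.isLinear.Build _ _ _ _ g g_lin.
pose gL : {linear L -> M} := HB.pack g gM.
have gE : linfun gL =1 g by exact: lfunE.
exists (linfun gL); split=> [|u v|u v]; rewrite ?gE.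
- by exists h => u; rewrite gE ?gK ?hK.
- apply: form_inj => w; rewrite -{1}(hK w) form_g.
  rewrite -[LHS]/(tri _ _ _) -[RHS]/(tri _ _ _) triL triM.
  by apply: eq_bigr => e _; rewrite /wedge !g_dual !h_dual.
- exact: form_g.
Qed.

Lemma has_presentation_iso L M :
  saa_isomorphic L M -> has_presentation L P -> has_presentation M P.
Proof.
case=> f [f_bij f_mul f_form] [b [[b_basis bxx byy bxy] b_eq b_eq0]].
exists (f \o b); split=> [|u v w a /b_eq <-|u v w /b_eq0 <-] /=.
- split=> [|i j|i j|i j] /=; rewrite ?f_form //.
  have <- : (f @: fullv = fullv)%VS.
    have [h _ hK] := f_bij; apply/eqP; rewrite eqEsubv subvf.
    by apply/subvP => v _; rewrite -(hK v) memv_img ?memvf.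
  rewrite codomE map_comp -codomE limg_basis_of //.
  suff /eqP-> : lker f == 0%VS by rewrite capv0.
  by apply/lker0P; exact: bij_inj.
- by rewrite -!f_mul f_form.
- by rewrite -!f_mul f_form.
Qed.

End Isomorphism.

(** * Nilpotency from a weighting of the basis *)

Section WeightFiltration.

Variables (F : fieldType) (n : nat).
Implicit Type P : presentation F n.

(** If (uv, w) is nonzero on basis elements then uv has a component along the
    basis element paired with w; the condition says that this component is
    heavier than u. *)
Definition weighted (wt : sgen n -> nat) P : bool :=
  all (fun e => all (fun a => all (fun c =>
    (a != c) ==> (wt a < wt (star c))%N) (triple e)) (triple e)) P.

(** Right multiplication raises the weight, so L^(i+1) lies in the span of the
    basis elements of weight at least i. *)
Lemma saa_pow_weighted (L : SAA F) (wt : sgen n -> nat) P m :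
  weighted wt P -> has_presentation L P -> (forall k, (wt k < m)%N) ->
  saa_pow L m.+1 = 0%VS.
Proof.
move=> wtP [b [b_std _ b_eq0]] wt_lt.
have alt := alternating3_tri L.
have b_basis : basis_of fullv (codom b) by case: b_std.
pose W i := <<[seq b k | k <- enum (sgen n) & (i <= wt k)%N]>>%VS.
have memW i k : (i <= wt k)%N -> b k \in W i.
  by move=> le_i; rewrite memv_span // map_f // mem_filter le_i mem_enum.
suff powW i : (saa_pow L i.+1 <= W i)%VS.
  apply/eqP; rewrite -subv0 (subv_trans (powW m)) // /W; apply/span_subvP => v.
  by case/mapP => k; rewrite mem_filter leqNgt wt_lt.
elim: i => [|i IH].
  rewrite /saa_pow /= -(span_basis b_basis); apply/span_subvP => _ /codomP[k ->].
  exact: memW.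
rewrite -[saa_pow L i.+2]/(saa_prodv (saa_pow L i.+1) fullv).
apply/saa_prodvP => u v /(subvP IH) uW _.
rewrite [saa_mul L u v](standard_sum _ b_std) memv_suml // => k _.
have [lt_ik|le_ki] := ltnP i (wt k).
  by rewrite memvZ // memW.
suff tri0 : tri u v (b (star k)) = 0.
  rewrite form_sym (_ : form _ _ = 0) ?oppr0 ?scale0r ?mem0v //.
  by case: k tri0 {le_ki} => j /=; rewrite ?formNr -/(tri _ _ _) => ->; rewrite ?oppr0.
move: u uW; apply: linear_span_eq0 => [a u u'|_ /mapP[j j_wt ->]].
  exact: (alt3_linear1 alt).
have: v \in <<codom b>>%VS by rewrite (span_basis b_basis) memvf.
move: v; apply: linear_span_eq0 => [a v v'|_ /codomP[l ->]].
  exact: (alt3_linear2 alt).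
have [->|jk] := eqVneq j (star k); first exact: (alt3_eq0m alt).
apply: b_eq0 => u' v' w' a eP; apply/negP => /perm_mem mem_e.
have /allP/(_ j) := allP wtP _ eP; rewrite -mem_e mem_head => /(_ isT)/allP/(_ (star k)).
rewrite -mem_e !inE eqxx !orbT jk => /(_ isT).
rewrite mem_filter in j_wt; case/andP: j_wt => le_ij _.
have -> : star (star k) = k by case: (k).
by rewrite ltnNge (leq_trans le_ki).
Qed.

End WeightFiltration.

(** * Lagrangian flags of ideals *)

Section Lagrangian.

Variables (F : fieldType) (L : SAA F).
Implicit Types (s : seq L) (u v w z : L).

Definition pairing s u : 'rV[F]_(size s) := \row_(i < size s) form s`_i u.

Lemma pairing_linear s : linear (pairing s).
Proof. by move=> a u v; apply/rowP => i; rewrite !mxE formDr formZr. Qed.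

HB.instance Definition _ s :=
  GRing.isLinear.Build F L 'rV[F]_(size s) _ (pairing s) (pairing_linear s).

Definition perp s : {vspace L} := lker (linfun (pairing s)).

Lemma perpP s u : reflect (forall x, x \in s -> form x u = 0) (u \in perp s).
Proof.
rewrite memv_ker lfunE /=; apply: (iffP eqP) => [pu x /(nthP 0)[i lt_i <-]|pu].
  by have /rowP/(_ (Ordinal lt_i)) := pu; rewrite !mxE.
by apply/rowP => i; rewrite !mxE pu // mem_nth.
Qed.

Lemma perp_span s u x : u \in perp s -> x \in <<s>>%VS -> form x u = 0.
Proof.
move/perpP=> pu; move: x; apply: linear_span_eq0 => // a v w.
by rewrite formDl formZl.
Qed.

Lemma dim_perp s : (\dim {:L} <= \dim (perp s) + size s)%N.
Proof.
rewrite -(limg_ker_dim (linfun (pairing s)) fullv) capfv leq_add2l.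
by apply: leq_trans (dimvS (subvf _)) _; rewrite dimvf /dim /= mul1n.
Qed.

(** The orthogonal of s has dimension at least dim L - size s > size s. *)
Lemma perp_notin s : (2 * size s < \dim {:L})%N ->
  exists2 z, z \in perp s & z \notin <<s>>%VS.
Proof.
move=> lt_s; apply/subvPn/negP => /dimvS le_d.
have := leq_trans (dim_perp s) (leq_add (leq_trans le_d (dim_span s)) (leqnn _)).
by rewrite addnn -mul2n leqNgt lt_s.
Qed.

(** The pairing with a basis is injective by nondegeneracy, hence onto by
    dimension. *)
Lemma form_representation (f : L -> F) :
  (forall a u v, f (a *: u + v) = a * f u + f v) ->
  exists z, forall u, form u z = f u.
Proof.
move=> f_lin; pose s := vbasis {:L}.
have s_basis : basis_of {:L} s := vbasisP _.
have ker0 : lker (linfun (pairing s)) == 0%VS.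
  rewrite -subv0; apply/subvP => z zs; rewrite memv0; apply/eqP/form_inj => w.
  rewrite form_sym form0l (perp_span zs) ?oppr0 //.
  by rewrite (span_basis s_basis) memvf.
have surj : (limg (linfun (pairing s)) = fullv)%VS.
  apply/eqP; rewrite -dimv_leqif_eq ?subvf // limg_dim_eq; last first.
    by rewrite (eqP ker0) capv0.
  by rewrite [X in _ == X]dimvf /dim /= mul1n size_tuple.
have /memv_imgP[z _ fE] : \row_(i < size s) f s`_i \in limg (linfun (pairing s)).
  by rewrite surj memvf.
exists z => u; apply/eqP; rewrite -subr_eq0; apply/eqP.
have: u \in <<s>>%VS by rewrite (span_basis s_basis) memvf.
move: u; apply: linear_span_eq0 => [a u v|_ /(nthP 0)[i lt_i <-]].
  by rewrite formDl formZl f_lin; ring.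
by have /rowP/(_ (Ordinal lt_i)) := fE; rewrite lfunE !mxE /= => ->; rewrite subrr.
Qed.

Lemma basis_of_standard n (b : sgen n -> L) : \dim {:L} = (2 * n)%N ->
  (forall i j, form (b (inl i)) (b (inl j)) = 0) ->
  (forall i j, form (b (inr i)) (b (inr j)) = 0) ->
  (forall i j, form (b (inl i)) (b (inr j)) = (i == j)%:R) ->
  standard_basis b.
Proof.
move=> dimL bxx byy bxy; split=> //.
have b_free : free (codom b).
  apply: (@free_dual _ _ _ b (fun k => form (dual b k))) => [k a u v|k l].
    exact: form_linear_r.
  case: k l => i [] j /=.
  - by rewrite formNl form_sym opprK bxy eq_sym.
  - by rewrite formNl byy oppr0.
  - exact: bxx.
  - exact: bxy.
rewrite basisEfree b_free subvf dimL size_codom card_sum card_ord /=.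
by rewrite addnn -mul2n leqnn.
Qed.

(** Vectors dual to the x's exist by nondegeneracy. They are made isotropic by
    subtracting from the i-th one a combination of the x_j with j < i: the sum
    over j < i, rather than half of the full sum, works in characteristic 2 and
    does not move an initial segment that is already isotropic. *)
Lemma lagrangian_completion n (x y : 'I_n -> L) (m : nat) :
  \dim {:L} = (2 * n)%N -> free (codom x) ->
  (forall i j, form (x i) (x j) = 0) ->
  (forall i j : 'I_n, (j < m)%N -> form (x i) (y j) = (i == j)%:R) ->
  (forall i j : 'I_n, (i < m)%N -> (j < m)%N -> form (y i) (y j) = 0) ->
  exists y' : 'I_n -> L, (forall i : 'I_n, (i < m)%N -> y' i = y i) /\
    standard_basis (fun k => match k with inl i => x i | inr i => y' i end).
Proof.
move=> dimL x_free xx xy yy.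
have /fin_all_exists[d dP] (i : 'I_n) : exists z, forall j, form (x j) z = (j == i)%:R.
  pose X := codom_tuple x.
  have [|z zE] := form_representation (f := coord X (enum_rank i)).
    by move=> a u v; rewrite linearP.
  exists z => j; rewrite zE.
  have -> : x j = X`_(enum_rank j).
    by rewrite /X /= codomE (nth_map j) -?cardE // nth_enum_rank.
  by rewrite coord_free // (inj_eq enum_rank_inj).
pose y0 (i : 'I_n) := if (i < m)%N then y i else d i.
have xy0 i j : form (x i) (y0 j) = (i == j)%:R.
  by rewrite /y0; case: ifP => [/xy|_].
pose corr (i : 'I_n) := \sum_(j < n | (j < i)%N) form (y0 i) (y0 j) *: x j.
have corrE i j : form (corr i) (y0 j) = if (j < i)%N then form (y0 i) (y0 j) else 0.
  rewrite form_suml; case: ifP => ji.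
    rewrite (bigD1 j) //= formZl xy0 eqxx mulr1 big1 ?addr0 // => l /andP[_ lj].
    by rewrite formZl xy0 (negPf lj) mulr0.
  apply: big1 => l li; rewrite formZl xy0.
  by case: eqP li ji => [-> ->|_ _ _]; rewrite ?mulr0.
have x_corr i j : form (x i) (corr j) = 0.
  by rewrite form_sumr big1 // => l _; rewrite formZr xx mulr0.
have corr2 i j : form (corr i) (corr j) = 0.
  by rewrite form_suml big1 // => l _; rewrite formZl x_corr mulr0.
exists (fun i => y0 i - corr i); split=> [i lt_im|].
  rewrite /y0 lt_im /corr big1 ?subr0 // => j lt_ji.
  by rewrite /y0 lt_im (ltn_trans lt_ji lt_im) yy ?scale0r // (ltn_trans lt_ji).
apply: basis_of_standard => // i j /=.
  rewrite formDl !formDr !formNl !formNr corrE corr2 (form_sym (y0 i) (corr j)) corrE.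
  case: (ltngtP i j) => [ij|ji|/val_inj->]; rewrite ?formxx ?(form_sym (y0 j)); ring.
by rewrite formDr formNr x_corr xy0 subr0.
Qed.

(** The tails of the list span a chain of isotropic ideals, each multiplied by L
    into the previous one; the head is the last vector added. *)
Fixpoint ideal_flag s : Prop :=
  if s is z :: s' then
    [/\ ideal_flag s', z \in perp s', z \notin <<s'>>%VS
      & forall u, saa_mul L z u \in <<s'>>%VS]
  else True.

Lemma ideal_flag_mul s : ideal_flag s ->
  forall x u, x \in s -> saa_mul L x u \in <<s>>%VS.
Proof.
elim: s => //= z s IH [s_flag _ _ z_mul] x u; rewrite inE span_cons.
case/predU1P=> [->|xs]; apply: (subvP (addvSr _ _)); first exact: z_mul.
exact: IH.
Qed.

Lemma ideal_flag_nth s i u : ideal_flag s -> (i < size s)%N ->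
  saa_mul L s`_i u \in <<drop i.+1 s>>%VS.
Proof.
elim: s i => //= z s IH [|i] [s_flag _ _ z_mul] lt_i; first by rewrite drop0.
exact: IH.
Qed.

Lemma ideal_flag_free s : ideal_flag s -> free s.
Proof.
elim: s => [|z s IH] /=; first by rewrite nil_free.
by case=> s_flag _ zs _; rewrite free_cons zs IH.
Qed.

Lemma ideal_flag_isotropic s : ideal_flag s ->
  forall x y, x \in s -> y \in s -> form x y = 0.
Proof.
elim: s => //= z s IH [s_flag /perpP zs _ _] x y; rewrite !inE.
case/predU1P=> [->|xs]; case/predU1P=> [->|ys]; rewrite ?formxx ?zs //.
  by rewrite form_sym zs ?oppr0.
exact: IH.
Qed.

(** The orthogonal P of the ideal I spanned by s is an ideal. In the chain P,
    PL, (PL)L, ..., which reaches 0, take the last term not contained in I, and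
    in it a vector outside I. *)
Lemma ideal_flag_extend s : saa_nilpotent L -> ideal_flag s ->
  (2 * size s < \dim {:L})%N -> exists z, ideal_flag (z :: s).
Proof.
case=> N powN s_flag lt_s; have alt := alternating3_tri L.
have perp_ideal z u : z \in perp s -> saa_mul L z u \in perp s.
  move=> zs; apply/perpP => x xs; rewrite form_sym -/(tri z u x).
  rewrite (alt3_cycle alt) (alt3_swap alt) opprK /tri (perp_span zs) //.
  exact: ideal_flag_mul.
pose next (U : {vspace L}) := saa_prodv U fullv.
have step k (U : {vspace L}) : (U <= perp s)%VS -> (iter k next U <= <<s>>)%VS ->
    ~~ (U <= <<s>>)%VS -> exists z, ideal_flag (z :: s).
  elim: k U => [|k IH] U U_perp U_iter U_s; first by rewrite [(U <= _)%VS]U_iter in U_s.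
  have [UL_s|UL_s] := boolP (next U <= <<s>>)%VS; last first.
    apply: (IH (next U)) => //; last by rewrite -iterSr.
    by apply/saa_prodvP => u v /(subvP U_perp) u_perp _; exact: perp_ideal.
  have /subvPn[z zU zs] := U_s; exists z; split=> //; first exact: (subvP U_perp).
  by move=> u; apply: (saa_prodvP _ _ _ UL_s) => //; exact: memvf.
apply: (step N (perp s)) => //; last first.
  by apply/subvPn; exact: perp_notin.
have /subv_trans-> // : (iter N next (perp s) <= saa_pow L N.+1)%VS.
  elim: (N) => [|k IH]; first exact: subvf.
  rewrite iterS -[saa_pow L k.+2]/(next (saa_pow L k.+1)).
  apply/saa_prodvP => u v /(subvP IH) uP _; exact: saa_memv_prodv (memvf _).
by rewrite powN sub0v.
Qed.

(** Here x_i is the (n - i + 1)-th vector added to the flag, so that x_i L lies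
    in the span of the x_l with l > i, which is orthogonal to all the x's and to
    the y_j with j <= i. *)
Lemma nilpotent_basis n : saa_nilpotent L -> \dim {:L} = (2 * n)%N ->
  exists b : sgen n -> L,
  [/\ standard_basis b,
      forall i j v, tri (b (inl i)) v (b (inl j)) = 0
    & forall (i j : 'I_n) v, (j <= i)%N -> tri (b (inl i)) v (b (inr j)) = 0].
Proof.
move=> nilL dimL.
have [s s_flag s_size] : exists2 s, ideal_flag s & size s = n.
  have: (n <= n)%N by [].
  elim: {1 3}n => [|k IH] lt_kn; first by exists nil.
  have [s s_flag s_size] := IH (ltnW lt_kn).
  have [|z zs] := ideal_flag_extend nilL s_flag; last by exists (z :: s); rewrite //= s_size.
  by rewrite dimL s_size ltn_mul2l.
pose x (i : 'I_n) := s`_i.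
have xs i : x i \in s by rewrite mem_nth // s_size.
have codom_x : codom x = s.
  by rewrite codomE [LHS](map_comp (nth 0 s) val) val_enum_ord -s_size map_nth_iota0 ?take_size.
have [|i j|||y [_ b_std]] := @lagrangian_completion n x (fun=> 0) 0 dimL => //.
- by rewrite codom_x ideal_flag_free.
- exact: (ideal_flag_isotropic s_flag).
exists (fun k => match k with inl i => x i | inr i => y i end).
split=> // [i j v|i j v le_ji] /=.
  apply: perp_span (ideal_flag_mul s_flag v (xs i)).
  by apply/perpP => z zs; exact: (ideal_flag_isotropic s_flag).
have := ideal_flag_nth v s_flag (_ : i < size s)%N; rewrite s_size => /(_ (ltn_ord i)).
rewrite -/(x i) /tri; move: (saa_mul L _ _); apply: linear_span_eq0 => [a u w|].
  by rewrite formDl formZl.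
move=> z /(nthP 0)[k]; rewrite size_drop s_size nth_drop => lt_k <-.
have lt_n : (i.+1 + k < n)%N by rewrite -ltn_subRL.
have [_ _ _ /(_ (Ordinal lt_n) j)] := b_std => /= xy; rewrite [LHS]xy.
by rewrite -val_eqE /= gtn_eqF // (leq_ltn_trans le_ji) // ltnS leq_addr.
Qed.

End Lagrangian.

(** * The presentations of the classification *)

Section Indices.

Variable n : nat.
Implicit Types i j : nat.

Lemma eqXX i j : (0 < i <= n.+1)%N -> (0 < j <= n.+1)%N ->
  (X i == X j :> sgen n.+1) = (i == j).
Proof.
case: i j => [|i] [|j] // le_i le_j.
by rewrite (inj_eq (@inl_inj _ _)) -val_eqE /= !inordK.
Qed.

Lemma eqYY i j : (0 < i <= n.+1)%N -> (0 < j <= n.+1)%N ->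
  (Y i == Y j :> sgen n.+1) = (i == j).
Proof.
case: i j => [|i] [|j] // le_i le_j.
by rewrite (inj_eq (@inr_inj _ _)) -val_eqE /= !inordK.
Qed.

Lemma eqXY i j : (X i == Y j :> sgen n.+1) = false.
Proof. by []. Qed.

Lemma eqYX i j : (Y i == X j :> sgen n.+1) = false.
Proof. by []. Qed.

End Indices.

Definition eq_index := (eqXX, eqYY, eqXY, eqYX).

Section Presentations.

Variable F : fieldType.

Lemma coherent_P6_31 : coherent (P6_31 F).
Proof. by rewrite /coherent /= !inE !eq_index. Qed.

Lemma coherent_P8_51 : coherent (P8_51 F).
Proof. by rewrite /coherent /= !inE !eq_index. Qed.

Lemma coherent_P8_32 : coherent (P8_32 F).
Proof. by rewrite /coherent /perm_eq /= !inE !eq_index. Qed.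

Lemma coherent_P8_23 (r : F) : coherent (P8_23 r).
Proof. by rewrite /coherent /perm_eq /= !inE !eq_index. Qed.

Lemma wedgeN (L : SAA F) (a b c u v w : L) :
  wedge (form (- a)) (form b) (form c) u v w
  = - wedge (form a) (form b) (form c) u v w.
Proof. by rewrite /wedge !formNl; ring. Qed.

(** In trivector notation the presentations below are x1 /\ x2 /\ x3,
    x1 /\ x2 /\ x3 - y1 /\ x3 /\ x4 and
    x1 /\ x2 /\ x3 - y1 /\ x2 /\ x4 - r (y2 /\ x3 /\ x4): the functional
    giving the y_i-coordinate is (x_i, -), the one giving the x_i-coordinate is
    (- y_i, -). *)
Lemma has_P6_31P (L : SAA F) : has_presentation L (P6_31 F) <->
  exists b : sgen 3 -> L, standard_basis b /\ forall u v w,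
    tri u v w = wedge (form (b (X 1))) (form (b (X 2))) (form (b (X 3))) u v w.
Proof.
rewrite has_presentationP ?coherent_P6_31 //.
split=> -[b [b_std triE]]; exists b; split=> // u v w; rewrite triE;
  by rewrite /presentation_form big_seq1 mul1r.
Qed.

Lemma has_P8_51P (L : SAA F) : has_presentation L (P8_51 F) <->
  exists b : sgen 4 -> L, standard_basis b /\ forall u v w,
    tri u v w = wedge (form (b (X 1))) (form (b (X 2))) (form (b (X 3))) u v w.
Proof.
rewrite has_presentationP ?coherent_P8_51 //.
split=> -[b [b_std triE]]; exists b; split=> // u v w; rewrite triE;
  by rewrite /presentation_form big_seq1 mul1r.
Qed.

Lemma has_P8_32P (L : SAA F) : has_presentation L (P8_32 F) <->
  exists b : sgen 4 -> L, standard_basis b /\ forall u v w,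
    tri u v w = wedge (form (b (X 1))) (form (b (X 2))) (form (b (X 3))) u v w
              - wedge (form (b (Y 1))) (form (b (X 3))) (form (b (X 4))) u v w.
Proof.
rewrite has_presentationP ?coherent_P8_32 //.
split=> -[b [b_std triE]]; exists b; split=> // u v w; rewrite triE;
  by rewrite /presentation_form !big_cons big_nil addr0 /= wedgeN !mul1r.
Qed.

Lemma has_P8_23P (L : SAA F) (r : F) : has_presentation L (P8_23 r) <->
  exists b : sgen 4 -> L, standard_basis b /\ forall u v w,
    tri u v w = wedge (form (b (X 1))) (form (b (X 2))) (form (b (X 3))) u v w
              - wedge (form (b (Y 1))) (form (b (X 2))) (form (b (X 4))) u v w
              - r * wedge (form (b (Y 2))) (form (b (X 3))) (form (b (X 4))) u v w.
Proof.
rewrite has_presentationP ?coherent_P8_23 //.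
split=> -[b [b_std triE]]; exists b; split=> // u v w; rewrite triE;
  rewrite /presentation_form !big_cons big_nil addr0 /= !wedgeN; ring.
Qed.

Section StandardIndices.

Variables (L : SAA F) (n : nat) (b : sgen n.+1 -> L).
Hypothesis b_std : standard_basis b.
Implicit Types i j : nat.

Lemma formXX i j : form (b (X i)) (b (X j)) = 0.
Proof. by case: b_std => _ bxx _ _; exact: bxx. Qed.

Lemma formYY i j : form (b (Y i)) (b (Y j)) = 0.
Proof. by case: b_std => _ _ byy _; exact: byy. Qed.

Lemma formXY i j : (0 < i <= n.+1)%N -> (0 < j <= n.+1)%N ->
  form (b (X i)) (b (Y j)) = (i == j)%:R.
Proof.
move=> le_i le_j; rewrite -(eqXX le_i le_j) (inj_eq (@inl_inj _ _)).
by case: b_std => _ _ _ bxy; exact: bxy.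
Qed.

Lemma formYX i j : (0 < i <= n.+1)%N -> (0 < j <= n.+1)%N ->
  form (b (Y i)) (b (X j)) = - (j == i)%:R.
Proof. by move=> le_i le_j; rewrite form_sym formXY. Qed.

End StandardIndices.

(** Only the basis vectors that occur in the trivector need to be exhibited. *)
Lemma standard_basis_completion (L : SAA F) n (xs ys : seq L) :
  size xs = n.+1 -> (size ys <= n.+1)%N -> \dim {:L} = (2 * n.+1)%N -> free xs ->
  (forall i j, (i < n.+1)%N -> (j < n.+1)%N -> form xs`_i xs`_j = 0) ->
  (forall i j, (i < n.+1)%N -> (j < size ys)%N ->
     form xs`_i ys`_j = (i == j)%:R) ->
  (forall i j, (i < size ys)%N -> (j < size ys)%N -> form ys`_i ys`_j = 0) ->
  exists b : sgen n.+1 -> L,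
  [/\ standard_basis b, forall i, (i < n.+1)%N -> b (X i.+1) = xs`_i
    & forall i, (i < size ys)%N -> b (Y i.+1) = ys`_i].
Proof.
move=> size_xs size_ys dimL xs_free xx xy yy.
pose x (i : 'I_n.+1) := xs`_i; pose y (i : 'I_n.+1) := ys`_i.
have codom_x : codom x = xs.
  by rewrite codomE [LHS](map_comp (nth 0 xs) val) val_enum_ord -size_xs map_nth_iota0 ?take_size.
have [||||y' [y'E b_std]] := @lagrangian_completion _ _ _ x y (size ys) dimL.
- by rewrite codom_x.
- by move=> i j; exact: xx.
- by move=> i j lt_j; rewrite xy.
- by move=> i j; exact: yy.
exists (fun k => match k with inl i => x i | inr i => y' i end).
split=> // i lt_i; first by rewrite /= /x inordK.
have lt_in := leq_trans lt_i size_ys.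
by rewrite /= y'E /y /= inordK.
Qed.

Lemma free_cons_form (L : SAA F) (x z : L) (s : seq L) :
  (forall y, y \in s -> form y z = 0) -> form x z != 0 -> free s -> free (x :: s).
Proof.
move=> sz xz s_free; rewrite free_cons s_free andbT; apply: contra xz => xs.
apply/eqP; move: x xs; apply: linear_span_eq0 => // a u v.
by rewrite formDl formZl.
Qed.

End Presentations.

(** * Nilpotency classes *)

Section Invariants.

Local Arguments star : simpl never.

Variable F : fieldType.
Implicit Type L : SAA F.

Lemma describes_weighted n (P : presentation F n) (wt : sgen n -> nat) m e :
  coherent P -> weighted wt P -> (forall k, (wt k < m)%N) ->
  e \in P -> e.2 != 0 -> describes_nonabelian_nilpotent P.
Proof.
move=> P_coh wtP wt_lt eP e_n0; split=> [|L M|L LP].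
- by exists (model_saa P); exact: model_has_presentation.
- exact: saa_isomorphic_of_presentation.
split; first by exists m; exact: saa_pow_weighted wtP LP wt_lt.
move/abelianP => tri0; case: LP => b [_ b_eq _]; case/eqP: e_n0.
case: e eP => [[[u v] w] a] /b_eq /= <-; exact: tri0.
Qed.

(** Elements beyond the end of either list have weight 0. *)
Definition weights (n : nat) (xs ys : seq nat) (k : sgen n) : nat :=
  match k with inl i => nth 0%N xs i | inr i => nth 0%N ys i end.

Local Arguments weights : simpl never.

Lemma weights_lt xs ys n m (k : sgen n) :
  all (fun w => w < m.+1)%N (xs ++ ys) -> (weights xs ys k < m.+1)%N.
Proof.
rewrite all_cat => /andP[/allP xs_lt /allP ys_lt].
case: k => i; rewrite /weights.
  have [lt_i|le_i] := ltnP i (size xs); last by rewrite nth_default.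
  exact: xs_lt (mem_nth _ lt_i).
have [lt_i|le_i] := ltnP i (size ys); last by rewrite nth_default.
exact: ys_lt (mem_nth _ lt_i).
Qed.

Lemma weightsX xs ys n i : (0 < i <= n.+1)%N ->
  weights xs ys (X i : sgen n.+1) = nth 0%N xs i.-1.
Proof. by case: i => // i le_i; rewrite /weights /= inordK. Qed.

Lemma weightsY xs ys n i : (0 < i <= n.+1)%N ->
  weights xs ys (Y i : sgen n.+1) = nth 0%N ys i.-1.
Proof. by case: i => // i le_i; rewrite /weights /= inordK. Qed.

Lemma starX n i : star (X i : sgen n.+1) = Y i.
Proof. by []. Qed.

Lemma starY n i : star (Y i : sgen n.+1) = X i.
Proof. by []. Qed.

Definition weightE := (starX, starY, weightsX, weightsY).

Lemma weighted_P6_31 : weighted (weights [:: 1; 1; 1] [::])%N (P6_31 F).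
Proof. by rewrite /weighted /= !eq_index // !weightE. Qed.

Lemma weighted_P8_51 : weighted (weights [:: 1; 1; 1] [::])%N (P8_51 F).
Proof. by rewrite /weighted /= !eq_index // !weightE. Qed.

Lemma weighted_P8_32 :
  weighted (weights [:: 1; 2; 2; 2] [:: 1])%N (P8_32 F).
Proof. by rewrite /weighted /= !eq_index // !weightE. Qed.

Lemma weighted_P8_23 (r : F) :
  weighted (weights [:: 2; 3; 4; 4] [:: 2; 1])%N (P8_23 r).
Proof. by rewrite /weighted /= !eq_index // !weightE. Qed.

Lemma saa_pow3_P8_51 L : has_presentation L (P8_51 F) -> saa_pow L 3 = 0%VS.
Proof.
move=> LP; apply: (saa_pow_weighted weighted_P8_51 LP) => k.
exact: weights_lt.
Qed.

Lemma saa_pow4_P8_32 L : has_presentation L (P8_32 F) -> saa_pow L 4 = 0%VS.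
Proof.
move=> LP; apply: (saa_pow_weighted weighted_P8_32 LP) => k.
exact: weights_lt.
Qed.

Lemma saa_pow3_neq0 L u v w z : tri (saa_mul L u v) w z != 0 ->
  saa_pow L 3 != 0%VS.
Proof.
apply: contraNneq => L3; rewrite /tri (_ : saa_mul L _ w = 0) ?form0l //.
apply/eqP; rewrite -memv0 -L3 /saa_pow /=.
by rewrite !saa_memv_prodv ?memvf.
Qed.

Lemma saa_pow4_neq0 L u v w z t : tri (saa_mul L (saa_mul L u v) w) z t != 0 ->
  saa_pow L 4 != 0%VS.
Proof.
apply: contraNneq => L4; rewrite /tri (_ : saa_mul L _ z = 0) ?form0l //.
apply/eqP; rewrite -memv0 -L4 /saa_pow /=.
by rewrite !saa_memv_prodv ?memvf.
Qed.

(** Here y3 y4 = - y1, and - y1 y2 = - x3 pairs with y3 to -1. *)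
Lemma saa_pow3_P8_32 L : has_presentation L (P8_32 F) -> saa_pow L 3 != 0%VS.
Proof.
case/has_P8_32P => b [b_std triE].
have stdE := (formXX b_std, formYY b_std, formXY b_std, formYX b_std).
apply: (@saa_pow3_neq0 L (b (Y 3)) (b (Y 4)) (b (Y 2)) (b (Y 3))).
have x1E : form (b (X 1)) (saa_mul L (b (Y 3)) (b (Y 4))) = -1.
  by rewrite form_sym -/(tri _ _ _) triE /wedge !stdE //=; ring.
set p := saa_mul L _ _ in x1E *.
suff -> : tri p (b (Y 2)) (b (Y 3)) = -1 by rewrite oppr_eq0 oner_neq0.
by rewrite triE /wedge !stdE //= x1E; ring.
Qed.

(** Here y3 y4 = - r y2, then (- r y2) y3 = - r x1 and (- r x1) y4 = r x2,
    which pairs with y2 to r. *)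
Lemma saa_pow4_P8_23 L r : r != 0 -> has_presentation L (P8_23 r) ->
  saa_pow L 4 != 0%VS.
Proof.
move=> r_n0 /has_P8_23P [b [b_std triE]].
have stdE := (formXX b_std, formYY b_std, formXY b_std, formYX b_std).
apply: (@saa_pow4_neq0 L (b (Y 3)) (b (Y 4)) (b (Y 3)) (b (Y 4)) (b (Y 2))).
have x2E : form (b (X 2)) (saa_mul L (b (Y 3)) (b (Y 4))) = - r.
  by rewrite form_sym -/(tri _ _ _) triE /wedge !stdE //=; ring.
set q := saa_mul L _ _ in x2E *.
have y1E : form (b (Y 1)) (saa_mul L q (b (Y 3))) = r.
  rewrite form_sym -/(tri _ _ _) triE /wedge !stdE //= x2E; ring.
set s := saa_mul L _ _ in y1E *.
suff -> : tri s (b (Y 4)) (b (Y 2)) = r by [].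
by rewrite triE /wedge !stdE //= y1E; ring.
Qed.

(** * The parameter r up to cubes *)

Lemma form_coordinates L (b : sgen 4 -> L) u v : standard_basis b ->
  form u v = \sum_(i < 4) (form (b (X i.+1)) u * form (b (Y i.+1)) v
                          - form (b (Y i.+1)) u * form (b (X i.+1)) v).
Proof.
move=> b_std; rewrite {1}(standard_sum u b_std) form_suml big_sumType /= addrC.
rewrite -big_split; apply: eq_bigr => i _ /=.
by rewrite !formZl formNl /X /Y /= inord_val; ring.
Qed.

(** The hypotheses express an isomorphism in coordinates: mu and la are the
    diagonal entries at x2 and y2, the matrix (a, a'; d, d') describes x1, y1
    modulo heavier elements, and (e, e'; g, g') describes y3, y4 modulo L^2.
    The last four say that these two matrices are inverse to each other up to
    the factor la, a reordering and signs, so the second has determinant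
    mu^2. *)
Lemma cube_relations (r s mu la a a' d d' e e' g g' : F) : r != 0 ->
  mu * la = 1 -> a * d' - a' * d = 1 -> r * (mu * (e * g' - g * e')) = s ->
  la * (a * g - a' * g') = 1 -> la * (d * e - d' * e') = 1 ->
  la * (a * e - a' * e') = 0 -> la * (d * g - d' * g') = 0 -> s / r = mu ^+ 3.
Proof.
move=> r_n0 mu_la ad1 <- ag1 de1 ae0 dg0.
set m := e * g' - g * e'.
(* The determinant of the product of the two 2x2 matrices is 1. *)
have m_la2 : la ^+ 2 * m = 1.
  have : la ^+ 2 * ((a * d' - a' * d) * m)
      = la * (a * g - a' * g') * (la * (d * e - d' * e'))
        - la * (a * e - a' * e') * (la * (d * g - d' * g')) by rewrite /m; ring.
  by rewrite ad1 mul1r ag1 de1 ae0 mul0r subr0 mulr1.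
have : mu ^+ 2 * (la ^+ 2 * m) = (mu * la) ^+ 2 * m by ring.
rewrite m_la2 mu_la expr1n mul1r mulr1 => <-.
by rewrite mulrAC divff // mul1r -exprS.
Qed.

(** The vectors y2, x1, y1, x2 of the second basis are, up to scalars, products
    of its y3 and y4, so their leading coordinates in the first basis can be
    read off step by step; the forms (x2, y2), (x1, y1) and the values of tri
    then yield [cube_relations]. *)
Lemma P8_23_cube L r s : r != 0 -> s != 0 ->
  has_presentation L (P8_23 r) -> has_presentation L (P8_23 s) ->
  exists2 a : F, a != 0 & s / r = a ^+ 3.
Proof.
move=> r_n0 s_n0 /has_P8_23P[b [b_std triE]] /has_P8_23P[c [c_std triF]].
have bE := (formXX b_std, formYY b_std, formXY b_std, formYX b_std).
have cE := (formXX c_std, formYY c_std, formXY c_std, formYX c_std).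
have y2E : c (Y 2) = - s^-1 *: saa_mul L (c (Y 3)) (c (Y 4)).
  apply: form_inj => w; rewrite formZl -/(tri _ _ _) triF /wedge !cE //=; field.
  exact: s_n0.
have x1E : c (X 1) = saa_mul L (c (Y 2)) (c (Y 3)).
  apply: form_inj => w; rewrite -[RHS]/(tri _ _ _) triF /wedge !cE //=; ring.
have y1E : c (Y 1) = - saa_mul L (c (Y 2)) (c (Y 4)).
  apply: form_inj => w; rewrite formNl -/(tri _ _ _) triF /wedge !cE //=; ring.
have x2E : c (X 2) = - saa_mul L (c (X 1)) (c (Y 4)).
  apply: form_inj => w; rewrite formNl -/(tri _ _ _) triF /wedge !cE //=; ring.
(* Products have no component along y3 and y4, since x3 and x4 are central. *)
have x3_mul u v : form (b (X 3)) (saa_mul L u v) = 0.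
  by rewrite form_sym -/(tri _ _ _) triE /wedge !bE //=; ring.
have x4_mul u v : form (b (X 4)) (saa_mul L u v) = 0.
  by rewrite form_sym -/(tri _ _ _) triE /wedge !bE //=; ring.
have x3y2 : form (b (X 3)) (c (Y 2)) = 0 by rewrite y2E formZr x3_mul mulr0.
have x4y2 : form (b (X 4)) (c (Y 2)) = 0 by rewrite y2E formZr x4_mul mulr0.
have x3x1 : form (b (X 3)) (c (X 1)) = 0 by rewrite x1E x3_mul.
have x4x1 : form (b (X 4)) (c (X 1)) = 0 by rewrite x1E x4_mul.
have x3y1 : form (b (X 3)) (c (Y 1)) = 0 by rewrite y1E formNr x3_mul oppr0.
have x4y1 : form (b (X 4)) (c (Y 1)) = 0 by rewrite y1E formNr x4_mul oppr0.
have x3x2 : form (b (X 3)) (c (X 2)) = 0 by rewrite x2E formNr x3_mul oppr0.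
have x4x2 : form (b (X 4)) (c (X 2)) = 0 by rewrite x2E formNr x4_mul oppr0.
(* A product with an element of L^2 has no component along y2 either. *)
have x2_mul u v : form (b (X 3)) u = 0 -> form (b (X 4)) u = 0 ->
    form (b (X 2)) (saa_mul L u v) = 0.
  move=> x3u x4u.
  by rewrite form_sym -/(tri _ _ _) triE /wedge !bE //= x3u x4u; ring.
have x2x1 : form (b (X 2)) (c (X 1)) = 0 by rewrite x1E x2_mul.
have x2y1 : form (b (X 2)) (c (Y 1)) = 0 by rewrite y1E formNr x2_mul ?oppr0.
have x2x2 : form (b (X 2)) (c (X 2)) = 0 by rewrite x2E formNr x2_mul ?oppr0.
(* One more multiplication kills the components along y1 and x1. *)
have x1x2 : form (b (X 1)) (c (X 2)) = 0.
  rewrite x2E formNr form_sym -/(tri _ _ _) triE /wedge !bE //=.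
  by rewrite x2x1 x3x1 x4x1; ring.
have y1x2 : form (b (Y 1)) (c (X 2)) = 0.
  rewrite x2E formNr form_sym -/(tri _ _ _) triE /wedge !bE //=.
  by rewrite x2x1 x3x1 x4x1; ring.
have X2E := (x1x2, y1x2, x2x2, x3x2, x4x2).
have Y2E := (x3y2, x4y2).
have X1E := (x2x1, x3x1, x4x1).
have Y1E := (x2y1, x3y1, x4y1).
have eq_x2y2 : form (c (X 2)) (c (Y 2)) = 1 by rewrite cE.
have eq_x1y1 : form (c (X 1)) (c (Y 1)) = 1 by rewrite cE.
have eq_s : tri (c (X 2)) (c (Y 3)) (c (Y 4)) = s.
  by rewrite triF /wedge !cE //=; ring.
have eq_124 : tri (c (X 1)) (c (Y 2)) (c (Y 4)) = 1.
  by rewrite triF /wedge !cE //=; ring.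
have eq_123 : tri (c (Y 1)) (c (Y 2)) (c (Y 3)) = 1.
  by rewrite triF /wedge !cE //=; ring.
have eq_x123 : tri (c (X 1)) (c (Y 2)) (c (Y 3)) = 0.
  by rewrite triF /wedge !cE //=; ring.
have eq_y124 : tri (c (Y 1)) (c (Y 2)) (c (Y 4)) = 0.
  by rewrite triF /wedge !cE //=; ring.
move: eq_x2y2 eq_x1y1 eq_s eq_124 eq_123 eq_x123 eq_y124.
rewrite !triE !(form_coordinates _ _ b_std) !big_ord_recr !big_ord0 /= /wedge.
rewrite !X2E !Y2E !X1E !Y1E => e1 e2 e3 e4 e5 e6 e7.
exists (- form (b (Y 2)) (c (X 2))).
  by rewrite oppr_eq0; apply: contra_eq_neq e1 => ->; rewrite !mul0r !mulr0 !subr0 !addr0 eq_sym oner_neq0.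
apply: (@cube_relations r s _ (form (b (X 2)) (c (Y 2)))
  (form (b (X 1)) (c (X 1))) (form (b (Y 1)) (c (X 1)))
  (form (b (X 1)) (c (Y 1))) (form (b (Y 1)) (c (Y 1)))
  (form (b (X 3)) (c (Y 3))) (form (b (X 4)) (c (Y 3)))
  (form (b (X 3)) (c (Y 4))) (form (b (X 4)) (c (Y 4)))) => //.
- rewrite -[RHS]e1; ring.
- rewrite -[RHS]e2; ring.
- rewrite -[RHS]e3; ring.
- rewrite -[RHS]e4; ring.
- rewrite -[RHS]e5; ring.
- rewrite -[RHS]e6; ring.
- rewrite -[RHS]e7; ring.
Qed.

End Invariants.

(** * Recognising the presentations *)

Section NormalForms.

Variables (F : fieldType) (L : SAA F).
Implicit Types x y z : L.

Lemma P6_31_intro x1 x2 x3 : \dim {:L} = 6%N -> free [:: x1; x2; x3] ->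
  form x1 x2 = 0 -> form x1 x3 = 0 -> form x2 x3 = 0 ->
  (forall u v w, tri u v w = wedge (form x1) (form x2) (form x3) u v w) ->
  has_presentation L (P6_31 F).
Proof.
move=> dimL x_free f12 f13 f23 triE; apply/has_P6_31P.
have [|||b [b_std bX _]]
  := @standard_basis_completion F L 2 [:: x1; x2; x3] [::]
       erefl isT dimL x_free => //.
  case=> [|[|[|i]]] [|[|[|j]]] //= _ _;
    rewrite ?formxx ?f12 ?f13 ?f23 //; by rewrite form_sym ?f12 ?f13 ?f23 oppr0.
by exists b; split=> // u v w; rewrite triE !bX.
Qed.

(** By dimension there is a fourth vector completing x1, x2, x3 to a basis of a
    Lagrangian subspace. *)
Lemma P8_51_intro x1 x2 x3 : \dim {:L} = 8%N -> free [:: x1; x2; x3] ->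
  form x1 x2 = 0 -> form x1 x3 = 0 -> form x2 x3 = 0 ->
  (forall u v w, tri u v w = wedge (form x1) (form x2) (form x3) u v w) ->
  has_presentation L (P8_51 F).
Proof.
move=> dimL x_free f12 f13 f23 triE; apply/has_P8_51P.
have [|z /perpP zP z_notin] := @perp_notin _ L [:: x1; x2; x3]; first by rewrite dimL.
have f14 : form x1 z = 0 by rewrite zP // !inE eqxx.
have f24 : form x2 z = 0 by rewrite zP // !inE eqxx ?orbT.
have f34 : form x3 z = 0 by rewrite zP // !inE eqxx ?orbT.
have x_free4 : free [:: x1; x2; x3; z].
  by rewrite (perm_free (permEl (perm_catC [:: x1; x2; x3] [:: z]))) free_cons z_notin.
have [|||b [b_std bX _]]
  := @standard_basis_completion F L 3 [:: x1; x2; x3; z] [::]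
       erefl isT dimL x_free4 => //.
  case=> [|[|[|[|i]]]] [|[|[|[|j]]]] //= _ _;
    rewrite ?formxx ?f12 ?f13 ?f23 ?f14 ?f24 ?f34 //;
    by rewrite form_sym ?f12 ?f13 ?f23 ?f14 ?f24 ?f34 oppr0.
by exists b; split=> // u v w; rewrite triE !bX.
Qed.

Lemma P8_32_intro x1 x2 x3 x4 y1 :
  \dim {:L} = 8%N -> free [:: x1; x2; x3; x4] ->
  form x1 x2 = 0 -> form x1 x3 = 0 -> form x1 x4 = 0 ->
  form x2 x3 = 0 -> form x2 x4 = 0 -> form x3 x4 = 0 ->
  form x1 y1 = 1 -> form x2 y1 = 0 -> form x3 y1 = 0 -> form x4 y1 = 0 ->
  (forall u v w, tri u v w = wedge (form x1) (form x2) (form x3) u v w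
                           - wedge (form y1) (form x3) (form x4) u v w) ->
  has_presentation L (P8_32 F).
Proof.
move=> dimL x_free f12 f13 f14 f23 f24 f34 f11 f21 f31 f41 triE.
apply/has_P8_32P.
have [|||b [b_std bX bY]]
  := @standard_basis_completion F L 3 [:: x1; x2; x3; x4] [:: y1]
       erefl isT dimL x_free => //.
- case=> [|[|[|[|i]]]] [|[|[|[|j]]]] //= _ _;
    rewrite ?formxx ?f12 ?f13 ?f23 ?f14 ?f24 ?f34 //;
    by rewrite form_sym ?f12 ?f13 ?f23 ?f14 ?f24 ?f34 oppr0.
- by case=> [|[|[|[|i]]]] [|j].
- by case=> [|i] [|j] //= _ _; rewrite formxx.
by exists b; split=> // u v w; rewrite triE !bX // bY.
Qed.

Lemma P8_23_intro r x1 x2 x3 x4 y1 y2 :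
  \dim {:L} = 8%N -> free [:: x1; x2; x3; x4] ->
  form x1 x2 = 0 -> form x1 x3 = 0 -> form x1 x4 = 0 ->
  form x2 x3 = 0 -> form x2 x4 = 0 -> form x3 x4 = 0 ->
  form x1 y1 = 1 -> form x2 y1 = 0 -> form x3 y1 = 0 -> form x4 y1 = 0 ->
  form x1 y2 = 0 -> form x2 y2 = 1 -> form x3 y2 = 0 -> form x4 y2 = 0 ->
  form y1 y2 = 0 ->
  (forall u v w, tri u v w = wedge (form x1) (form x2) (form x3) u v w
                           - wedge (form y1) (form x2) (form x4) u v w
                           - r * wedge (form y2) (form x3) (form x4) u v w) ->
  has_presentation L (P8_23 r).
Proof.
move=> dimL x_free f12 f13 f14 f23 f24 f34 f11 f21 f31 f41.
move=> g12 g22 g32 g42 h12 triE.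
apply/has_P8_23P.
have [|||b [b_std bX bY]]
  := @standard_basis_completion F L 3 [:: x1; x2; x3; x4] [:: y1; y2]
       erefl isT dimL x_free => //.
- case=> [|[|[|[|i]]]] [|[|[|[|j]]]] //= _ _;
    rewrite ?formxx ?f12 ?f13 ?f23 ?f14 ?f24 ?f34 //;
    by rewrite form_sym ?f12 ?f13 ?f23 ?f14 ?f24 ?f34 oppr0.
- by case=> [|[|[|[|i]]]] [|[|j]].
- by case=> [|[|i]] [|[|j]] //= _ _; rewrite ?formxx ?h12 // form_sym h12 oppr0.
by exists b; split=> // u v w; rewrite triE !bX // !bY.
Qed.

Lemma dim_standard n (b : sgen n -> L) :
  standard_basis b -> \dim {:L} = (2 * n)%N.
Proof.
case=> b_basis _ _ _.
rewrite -(span_basis b_basis) (eqP (basis_free b_basis)) size_codom.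
by rewrite card_sum card_ord addnn mul2n.
Qed.

(** A triangular matrix of pairings with nonzero diagonal. *)
Fixpoint triangular (xs zs : seq L) : bool :=
  match xs, zs with
  | x :: xs', z :: zs' =>
    [&& form x z != 0, all (fun y => form y z == 0) xs' & triangular xs' zs']
  | [::], [::] => true
  | _, _ => false
  end.

Lemma free_triangular xs zs : triangular xs zs -> free xs.
Proof.
elim: xs zs => [|x xs IH] [|z zs] //=; first by rewrite nil_free.
case/and3P=> xz /allP xs_z /IH xs_free.
by apply: free_cons_form xz xs_free => y /xs_z/eqP.
Qed.

(** Rescale x2, x3, x4 by a, 1/a, 1/a and keep x1: the first two terms of the
    trivector are unchanged and the third one is multiplied by a^3. *)
Lemma P8_23_scale r a : a != 0 -> has_presentation L (P8_23 r) ->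
  has_presentation L (P8_23 (r * a ^+ 3)).
Proof.
move=> a_n0 /has_P8_23P[b [b_std triE]].
have bE := (formXX b_std, formYY b_std, formXY b_std, formYX b_std).
apply: (@P8_23_intro _ (b (X 1)) (a *: b (X 2)) (a^-1 *: b (X 3)) (a^-1 *: b (X 4))
  (b (Y 1)) (a^-1 *: b (Y 2))).
- exact: dim_standard b_std.
- apply: (@free_triangular _ [:: b (Y 1); b (Y 2); b (Y 3); b (Y 4)]).
  by rewrite /= !formZl !bE //= !mulr0 !mulr1 !eqxx ?oner_neq0 ?invr_eq0 a_n0.
all: try by rewrite ?formZl ?formZr ?bE //= ?mulr0 ?mulr1 ?divff.
move=> u v w; rewrite triE /wedge !formZl; field; exact: a_n0.
Qed.

(** * The cases of dimension 8 *)

Section Dimension8.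

Hypothesis dimL : \dim {:L} = 8%N.

(** Used only to show that vectors are linearly independent. *)
Definition dual_pair z t : Prop :=
  exists p q, [/\ form z p = 1, form z q = 0, form t p = 0 & form t q = 1].

(** A symplectic basis x1, y1, x2, y2 of a 4-space, and z, t which together with
    x1, x2 span a Lagrangian subspace; the vectors paired with z and t are left
    free. *)
Definition frame x1 x2 y1 y2 z t : Prop :=
  [/\ form x1 y1 = 1, form x2 y2 = 1, form x1 x2 = 0, form x1 y2 = 0 &
    [/\ form x2 y1 = 0, form y1 y2 = 0, dual_pair z t, form z t = 0 &
       forall x, x \in [:: x1; x2; y1; y2] -> form x z = 0 /\ form x t = 0]].

(** All the values of the form on a frame, as a rewriting rule. *)
Lemma frameE x1 x2 y1 y2 z t : frame x1 x2 y1 y2 z t ->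
  ((form x1 y1 = 1) * (form x2 y2 = 1) * (form x1 x2 = 0) * (form x1 y2 = 0)
  * (form x2 y1 = 0) * (form y1 y2 = 0) * (form z t = 0)
  * (form x1 z = 0) * (form x2 z = 0) * (form y1 z = 0) * (form y2 z = 0)
  * (form x1 t = 0) * (form x2 t = 0) * (form y1 t = 0) * (form y2 t = 0)) *
  ((form y1 x1 = -1) * (form y2 x2 = -1) * (form x2 x1 = 0) * (form y2 x1 = 0)
  * (form y1 x2 = 0) * (form y2 y1 = 0) * (form t z = 0)
  * (form z x1 = 0) * (form z x2 = 0) * (form z y1 = 0) * (form z y2 = 0)
  * (form t x1 = 0) * (form t x2 = 0) * (form t y1 = 0) * (form t y2 = 0)).
Proof.
case=> f1 f2 f3 f4 [f5 f6 _ f7 fE].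
have [x1z x1t] : form x1 z = 0 /\ form x1 t = 0 by apply: fE; rewrite !inE eqxx.
have [x2z x2t] : form x2 z = 0 /\ form x2 t = 0 by apply: fE; rewrite !inE eqxx !orbT.
have [y1z y1t] : form y1 z = 0 /\ form y1 t = 0 by apply: fE; rewrite !inE eqxx !orbT.
have [y2z y2t] : form y2 z = 0 /\ form y2 t = 0 by apply: fE; rewrite !inE eqxx !orbT.
split; first by do !split.
by do !split; rewrite form_sym ?f1 ?f2 ?f3 ?f4 ?f5 ?f6 ?f7 ?x1z ?x2z ?x1t ?x2t
  ?y1z ?y1t ?y2z ?y2t ?oppr0.
Qed.

(** The trivector is a /\ z /\ t; if a is nonzero then a, z, t are independent,
    since a is in the symplectic 4-space orthogonal to z and t. *)
Lemma pencil_rank0 x1 x2 y1 y2 z t c1 d1 c2 d2 : frame x1 x2 y1 y2 z t ->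
  (forall u v w, tri u v w
     = wedge (form (c1 *: x1 + d1 *: y1 + c2 *: x2 + d2 *: y2)) (form z) (form t) u v w) ->
  saa_abelian L \/ has_presentation L (P8_51 F).
Proof.
move=> fr triE; have fE := frameE fr; have [_ _ _ _ [_ _ [p [q [zp zq tp tq]]] _ _]] := fr.
have zt_free : free [:: z; t].
  by apply: (@free_triangular _ [:: p; q]); rewrite /= zp tp tq eqxx oner_neq0.
set a := _ + _ in triE.
have aE : [/\ form a x1 = - d1, form a y1 = c1, form a x2 = - d2 & form a y2 = c2].
  by split; rewrite !formDl !formZl !(formxx, fE); ring.
case: aE => ax1 ay1 ax2 ay2.
have [a0|a_n0] := eqVneq a 0.
  left; apply/abelianP => u v w; rewrite triE a0 /wedge !form0l; ring.
right; apply: (@P8_51_intro a z t) => //.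
- rewrite free_cons zt_free andbT; apply: contra a_n0 => azt.
  have a_perp x : form z x = 0 -> form t x = 0 -> form a x = 0.
    move=> zx tx; move: (a) azt; apply: linear_span_eq0 => [k u v|y].
      by rewrite formDl formZl.
    by rewrite !inE => /orP[]/eqP->.
  apply/eqP; rewrite /a -ay1 -ay2 -[d1]opprK -ax1 -[d2]opprK -ax2.
  by rewrite !a_perp ?fE // oppr0 !scale0r !addr0.
- by rewrite !formDl !formZl !fE; ring.
- by rewrite !formDl !formZl !fE; ring.
- by rewrite fE.
Qed.

Definition classified8 : Prop :=
  [\/ saa_abelian L, has_presentation L (P8_51 F), has_presentation L (P8_32 F)
    | exists2 r : F, r != 0 & has_presentation L (P8_23 r)].

(** Replacing x2 by x2 + c1 t and x1 by x1 - c2 t absorbs the part of the first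
    factor along x1 and x2, and leaves x2' /\ x1' /\ z + e /\ z /\ t with
    e = d1 y1 + d2 y2. If e = 0 this is P8_51. Otherwise - e is taken as the new
    y1, and a basis X1, X2 of the plane of x1', x2', with the same X1 /\ X2, is
    chosen with (X1, - e) = 1 and (X2, - e) = 0. *)
Lemma pencil_rank1_aligned x1 x2 y1 y2 z t c1 d1 c2 d2 : frame x1 x2 y1 y2 z t ->
  (forall u v w, tri u v w
     = wedge (form (c1 *: x1 + d1 *: y1 + c2 *: x2 + d2 *: y2)) (form z) (form t) u v w
     + wedge (form x2) (form x1) (form z) u v w) ->
  classified8.
Proof.
move=> fr triE; have fE := frameE fr; have [_ _ _ _ [_ _ [p [q [zp zq tp tq]]] _ _]] := fr.
pose x2' := x2 + c1 *: t; pose x1' := x1 - c2 *: t; pose e := d1 *: y1 + d2 *: y2.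
have triE' u v w : tri u v w = wedge (form x2') (form x1') (form z) u v w
                             + wedge (form e) (form z) (form t) u v w.
  by rewrite triE /wedge !(formDl, formNl, formZl); ring.
pose formE := (formDl, formNl, formZl, formDr, formNr, formZr).
have [d2_0|d2_n0] := eqVneq d2 0; first have [d1_0|d1_n0] := eqVneq d1 0.
- apply: Or42; apply: (@P8_51_intro x2' x1' z) => //.
  + apply: (@free_triangular _ [:: y2; y1; p]).
    by rewrite /= !formE !fE zp !mulr0 !oppr0 !addr0 !eqxx oner_neq0.
  + by rewrite !formE !formxx !fE; ring.
  + by rewrite !formE !fE; ring.
  + by rewrite !formE !fE; ring.
  by move=> u v w; rewrite triE' /e d1_0 d2_0 /wedge !formE; ring.
- apply: Or43; apply: (@P8_32_intro (- d1^-1 *: x1') (d1 *: x2') z t (- e)) => //.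
  + apply: (@free_triangular _ [:: y1; y2; p; q]).
    rewrite /= !formE !fE zp tp tq.
    do ?[apply/andP; split]; rewrite ?oner_neq0 //; try by [apply/eqP; ring].
      by rewrite mulr0 subr0 mulr1 oppr_eq0 invr_eq0.
    by rewrite mulr0 addr0 mulr1.
  all: rewrite ?/e ?d2_0 ?formE ?formxx ?fE.
  all: try by [ring|field; exact: d1_n0].
  move=> u v w; rewrite triE' /e d2_0 /wedge !formE; field; exact: d1_n0.
- apply: Or43.
  apply: (@P8_32_intro (- d2^-1 *: x2') (d1 *: x2' - d2 *: x1') z t (- e)) => //.
  + apply: (@free_triangular _ [:: e; y1; p; q]).
    rewrite /= !formE ?formxx !fE zp tp tq.
    do ?[apply/andP; split]; rewrite ?oner_neq0 //; try by [apply/eqP; ring].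
      by rewrite [X in X != 0](_ : _ = -1) ?oppr_eq0 ?oner_neq0 //; field.
    by rewrite [X in X != 0](_ : _ = - d2) ?oppr_eq0 //; ring.
  all: rewrite ?/e ?formE ?formxx ?fE.
  all: try by [ring|field; exact: d2_n0].
  move=> u v w; rewrite triE' /e /wedge !formE; field; exact: d2_n0.
Qed.

(** A change of symplectic basis in the plane of x1 and y1 makes the given
    nonzero vector of this plane the new x1. *)
Lemma pencil_rank1 x1 x2 y1 y2 z t c1 d1 c2 d2 a b : frame x1 x2 y1 y2 z t ->
  (a != 0) || (b != 0) ->
  (forall u v w, tri u v w
     = wedge (form (c1 *: x1 + d1 *: y1 + c2 *: x2 + d2 *: y2)) (form z) (form t) u v w
     + wedge (form x2) (form (a *: x1 + b *: y1)) (form z) u v w) ->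
  classified8.
Proof.
move=> fr ab triE; have fE := frameE fr; have [_ _ _ _ [_ _ zt_dual _ _]] := fr.
pose formE := (formDl, formNl, formZl, formDr, formNr, formZr).
have [a0|a_n0] := eqVneq a 0.
  rewrite a0 eqxx /= in ab.
  apply: (@pencil_rank1_aligned (b *: y1) x2 (- b^-1 *: x1) y2 z t (d1 / b) (- b * c1) c2 d2).
    split; rewrite ?formE ?fE; try by [ring|field].
    split; rewrite ?formE ?fE //; try by [ring|field].
    by move=> x; rewrite !inE => /or4P[]/eqP->; rewrite ?formE !fE ?mulr0.
  by move=> u v w; rewrite triE a0 /wedge !formE; field.
apply: (@pencil_rank1_aligned (a *: x1 + b *: y1) x2 (a^-1 *: y1) y2 z t (c1 / a)
  (a * d1 - c1 * b) c2 d2).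
  split; rewrite ?formE ?formxx ?fE; try by [ring|field].
  split; rewrite ?formE ?formxx ?fE //; try by [ring|field].
  by move=> x; rewrite !inE => /or4P[]/eqP->; rewrite ?formE !fE ?mulr0 ?addr0.
by move=> u v w; rewrite triE /wedge !formE; field.
Qed.

(** The part of the first factor in the plane of x1 and y1 is a combination
    l w + l' w' of w = a x1 + b y1 and w' = a' x1 + b' y1. Replacing x2 by
    x2 + l t - l' z and w by w - c2 t absorbs it together with the part along
    x2. Multiplying t and dividing w' by the same scalar turns - w and w' into
    a symplectic pair, and only the part d2 y2 remains of the first factor. *)
Lemma pencil_rank2 x1 x2 y1 y2 z t c1 d1 c2 d2 a b a' b' : frame x1 x2 y1 y2 z t ->
  a * b' - b * a' != 0 ->
  (forall u v w, tri u v w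
     = wedge (form (c1 *: x1 + d1 *: y1 + c2 *: x2 + d2 *: y2)) (form z) (form t) u v w
     + wedge (form x2) (form (a *: x1 + b *: y1)) (form z) u v w
     + wedge (form x2) (form (a' *: x1 + b' *: y1)) (form t) u v w) ->
  classified8.
Proof.
move=> fr D_n0 triE; have fE := frameE fr.
have [_ _ _ _ [_ _ [p [q [zp zq tp tq]]] _ _]] := fr.
pose formE := (formDl, formNl, formZl, formDr, formNr, formZr).
set D := a * b' - b * a' in D_n0.
pose l := (c1 * b' - d1 * a') / D; pose l' := (a * d1 - b * c1) / D.
pose x2' := x2 + l *: t - l' *: z.
pose x1' := c2 *: t - (a *: x1 + b *: y1).
pose y1' := - D^-1 *: (a' *: x1 + b' *: y1).
have triE' u v w : tri u v w = wedge (form x1') (form x2') (form z) u v w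
    - wedge (form y1') (form x2') (form (- D *: t)) u v w
    - d2 / D * wedge (form y2) (form z) (form (- D *: t)) u v w.
  rewrite triE /wedge !formE /l /l' /D; field; exact: D_n0.
have fE' : [/\ form x1' x2' = 0, form x1' z = 0, form x1' t = 0, form x2' z = 0
  & form x2' t = 0].
  by split; rewrite !formE ?formxx !fE; ring.
have fE'' : [/\ form x1' y1' = 1, form x2' y1' = 0, form z y1' = 0 & form t y1' = 0].
  by split; rewrite !formE ?formxx !fE; [rewrite /D; field; exact: D_n0|ring|ring|ring].
have fE3 : [/\ form x1' y2 = 0, form x2' y2 = 1 & form y1' y2 = 0].
  by split; rewrite !formE ?formxx !fE; ring.
clearbody x1' x2' y1'.
case: fE' fE'' fE3 => f12 f13 f14 f23 f24 [f11 f21 f31 f41] [g12 g22 h12].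
have [d2_0|d2_n0] := eqVneq d2 0.
  apply: Or43; apply: (@P8_32_intro x1' (- z) x2' (- D *: t) y1') => //.
  - rewrite (perm_free (_ : perm_eq _ [:: x1'; x2'; - z; - D *: t])); last first.
      by apply/permP => P /=; ring.
    apply: (@free_triangular _ [:: y1'; y2; p; q]).
    rewrite /= !formE f11 f21 f31 f41 g22 !fE zp tp tq !mulr0 oppr0 mulr1 !eqxx.
    by rewrite !oppr_eq0 D_n0 oner_neq0.
  all: rewrite ?(formE, f12, f13, f14, f23, f24, f31, f41, fE) ?mulr0 ?oppr0 //.
  - by rewrite form_sym f23 !oppr0.
  by move=> u v w; rewrite triE' d2_0 /wedge !formE; ring.
apply: Or44; exists (d2 / D); first by rewrite mulf_neq0 ?invr_eq0.
apply: (@P8_23_intro _ x1' x2' z (- D *: t) y1' y2) => //.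
- apply: (@free_triangular _ [:: y1'; y2; p; q]).
  rewrite /= !formE f11 f21 f31 f41 g22 !fE zp tp tq !mulr0 mulr1 !eqxx.
  by rewrite !oppr_eq0 D_n0 oner_neq0.
all: by rewrite ?(formE, f14, f24, f41, fE) ?mulr0.
Qed.

End Dimension8.

End NormalForms.

(** * Classification *)

Section Classification.

Variables (F : fieldType) (L : SAA F).

(** When the two vectors of the plane are proportional, with the first nonzero
    and the second e times it, z + e t takes the place of z; when the first
    vanishes, the pair t, - z takes the place of z, t. *)
Lemma frame_classified x1 x2 y1 y2 z t c1 d1 c2 d2 a b a' b' :
  \dim {:L} = 8%N -> frame (L := L) x1 x2 y1 y2 z t ->
  (forall u v w, tri u v w
     = wedge (form (c1 *: x1 + d1 *: y1 + c2 *: x2 + d2 *: y2)) (form z) (form t) u v w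
     + wedge (form x2) (form (a *: x1 + b *: y1)) (form z) u v w
     + wedge (form x2) (form (a' *: x1 + b' *: y1)) (form t) u v w) ->
  classified8 L.
Proof.
move=> dimL fr triE; have fE := frameE fr.
have [f1 f2 f3 f4 [f5 f6 [p [q [zp zq tp tq]]] f7 _]] := fr.
pose formE := (formDl, formNl, formZl, formDr, formNr, formZr).
have [D_0|D_n0] := eqVneq (a * b' - b * a') 0; last exact: pencil_rank2 D_n0 triE.
have [ab0|] := boolP ((a == 0) && (b == 0)); last first.
  rewrite negb_and => ab_n0.
  have [e [a'E b'E]] : exists e, a' = e * a /\ b' = e * b.
    have [a0|a_n0] := eqVneq a 0; last first.
      exists (a' / a); rewrite mulfVK //; split=> //.
      by apply: (mulfI a_n0); rewrite (subr0_eq D_0); field.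
    rewrite a0 eqxx /= in ab_n0; exists (b' / b); rewrite mulfVK // a0 mulr0.
    split=> //; apply/eqP; move/eqP: D_0; rewrite a0 mul0r sub0r oppr_eq0.
    by rewrite mulf_eq0 (negPf ab_n0).
  apply: (@pencil_rank1 _ _ dimL x1 x2 y1 y2 (z + e *: t) t c1 d1 c2 d2 a b) => //.
    split=> //; split=> //.
    - by exists p, (q - e *: p); split; rewrite ?formE ?zp ?zq ?tp ?tq; ring.
    - by rewrite !formE formxx f7; ring.
    - by move=> x; rewrite !inE => /or4P[]/eqP->; rewrite !formE !fE mulr0 addr0.
  by move=> u v w; rewrite triE a'E b'E /wedge !formE; ring.
case/andP: ab0 => /eqP a0 /eqP b0; rewrite a0 b0 in triE.
have [/andP[/eqP a'0 /eqP b'0]|] := boolP ((a' == 0) && (b' == 0)).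
  have [|abL|LP] := @pencil_rank0 _ _ dimL x1 x2 y1 y2 z t c1 d1 c2 d2 fr.
  - by move=> u v w; rewrite triE a'0 b'0 /wedge !formE; ring.
  - exact: Or41.
  - exact: Or42.
rewrite negb_and => ab'_n0.
apply: (@pencil_rank1 _ _ dimL x1 x2 y1 y2 t (- z) c1 d1 c2 d2 a' b') => //.
  split=> //; split=> //.
  - by exists q, (- p); split; rewrite ?formE ?zp ?zq ?tp ?tq; ring.
  - by rewrite formNr fE oppr0.
  - by move=> x; rewrite !inE => /or4P[]/eqP->; rewrite !formE !fE oppr0.
by move=> u v w; rewrite triE /wedge !formE; ring.
Qed.

(** For forms agreeing on pairs of x's, the remaining triples of basis elements
    reduce by antisymmetry to these two families. *)
Lemma alt3_lagrangian_eq n (b : sgen n.+1 -> L) (f g : L -> L -> L -> F) :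
  standard_basis b -> alternating3 f -> alternating3 g ->
  (forall i j v, f (b (X i)) (b (X j)) v = g (b (X i)) (b (X j)) v) ->
  (forall i j k, (0 < i <= n.+1)%N -> (0 < j < k)%N -> (k <= n.+1)%N ->
     f (b (X i)) (b (Y j)) (b (Y k)) = g (b (X i)) (b (Y j)) (b (Y k))) ->
  (forall i j k, (0 < i)%N -> (i < j)%N -> (j < k)%N -> (k <= n.+1)%N ->
     f (b (Y i)) (b (Y j)) (b (Y k)) = g (b (Y i)) (b (Y j)) (b (Y k))) ->
  forall u v w, f u v w = g u v w.
Proof.
move=> b_std alt_f alt_g fg_xx fg_xyy fg_yyy.
have inlE (i : 'I_n.+1) : inl i = X i.+1 by rewrite /X inord_val.
have inrE (i : 'I_n.+1) : inr i = Y i.+1 by rewrite /Y inord_val.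
have [fC gC] := (alt3_cycle alt_f, alt3_cycle alt_g).
have [fS gS] := (alt3_swap alt_f, alt3_swap alt_g).
have [fl gl] := (alt3_eq0l alt_f, alt3_eq0l alt_g).
have [fr gr] := (alt3_eq0r alt_f, alt3_eq0r alt_g).
have [fm gm] := (alt3_eq0m alt_f, alt3_eq0m alt_g).
have xx (i j : 'I_n.+1) v : f (b (inl i)) (b (inl j)) v = g (b (inl i)) (b (inl j)) v.
  by rewrite !inlE.
have xyy (i j k : 'I_n.+1) :
    f (b (inl i)) (b (inr j)) (b (inr k)) = g (b (inl i)) (b (inr j)) (b (inr k)).
  have [jk|kj|/val_inj->] := ltngtP j k; last by rewrite fr gr.
    rewrite inlE !inrE; exact: (fg_xyy i.+1 j.+1 k.+1 (ltn_ord i) jk (ltn_ord k)).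
  rewrite -fC -gC fS gS inlE !inrE; congr (- _).
  exact: (fg_xyy i.+1 k.+1 j.+1 (ltn_ord i) kj (ltn_ord j)).
have yyy (i j k : 'I_n.+1) : (i < j)%N -> (j < k)%N ->
    f (b (inr i)) (b (inr j)) (b (inr k)) = g (b (inr i)) (b (inr j)) (b (inr k)).
  move=> ij jk; rewrite !inrE; exact: fg_yyy.
have b_basis : basis_of fullv (codom b) by case: b_std.
apply: (alt3_basis_eq alt_f alt_g b_basis) => -[] i [] j [] k.
- exact: xx.
- exact: xx.
- by rewrite -fC -gC xx.
- exact: xyy.
- by rewrite fC gC xx.
- by rewrite fS gS xyy.
- by rewrite -fC -gC xyy.
have [ij|ji|/val_inj->] := ltngtP i j; last by rewrite fl gl.
  have [jk|kj|/val_inj->] := ltngtP j k; last by rewrite fr gr.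
    exact: yyy.
  have [ik|ki|/val_inj->] := ltngtP i k; last by rewrite fm gm.
    by rewrite -fC -gC fS gS yyy.
  by rewrite -fC -gC yyy.
have [jk|kj|/val_inj->] := ltngtP j k; last by rewrite fr gr.
  have [ik|ki|/val_inj->] := ltngtP i k; last by rewrite fm gm.
    by rewrite fS gS yyy.
  by rewrite fC gC yyy.
by rewrite fC gC fS gS yyy.
Qed.

Lemma nilpotent_basisXY n : saa_nilpotent L -> \dim {:L} = (2 * n.+1)%N ->
  exists b : sgen n.+1 -> L,
  [/\ standard_basis b,
      forall i j v, tri (b (X i)) (b (X j)) v = 0,
      forall i j v, (0 < j <= i)%N -> (i <= n.+1)%N -> tri (b (X i)) v (b (Y j)) = 0
    & forall i j v, (0 < j <= i)%N -> (i <= n.+1)%N -> tri (b (X i)) (b (Y j)) v = 0].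
Proof.
move=> nilL dimL; have [b [b_std xx xy]] := nilpotent_basis nilL dimL.
have alt := alternating3_tri L.
have xy' i j v : (0 < j <= i)%N -> (i <= n.+1)%N -> tri (b (X i)) v (b (Y j)) = 0.
  case: i j => [|i] [|j] // le_ji le_i; have lt_j := leq_trans le_ji le_i.
  by rewrite xy //= !inordK.
exists b; split=> // [i j v|i j v le_ji le_i].
  by rewrite (alt3_cycle alt) xx.
by rewrite !(alt3_cycle alt (b (X i))) (alt3_cycle alt) (alt3_swap alt) xy' ?oppr0.
Qed.

Lemma nilpotent_abelian n : (n < 2)%N -> saa_nilpotent L ->
  \dim {:L} = (2 * n.+1)%N -> saa_abelian L.
Proof.
move=> lt_n2 nilL dimL; apply/abelianP.
have [b [b_std xx xy xy']] := nilpotent_basisXY nilL dimL.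
apply: (alt3_lagrangian_eq b_std (alternating3_tri L) (g := fun _ _ _ => 0)) => //.
- by split=> * //; rewrite mulr0 addr0.
- move=> i j k /andP[i_gt0 le_i] /andP[j_gt0 lt_jk] le_k; apply: xy' => //.
  rewrite j_gt0; apply: leq_trans i_gt0.
  exact: leq_trans lt_jk (leq_trans le_k lt_n2).
- move=> i j k i_gt0 lt_ij lt_jk le_k.
  have := leq_trans lt_jk (leq_trans le_k lt_n2).
  by rewrite ltnNge (leq_ltn_trans i_gt0 lt_ij).
Qed.

Lemma nilpotent_dim6 : saa_nilpotent L -> \dim {:L} = 6%N ->
  saa_abelian L \/ has_presentation L (P6_31 F).
Proof.
move=> nilL dimL; have [b [b_std xx xy xy']] := @nilpotent_basisXY 2 nilL dimL.
have bE := (formXX b_std, formYY b_std, formXY b_std, formYX b_std).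
pose formE := (formDl, formNl, formZl, formDr, formNr, formZr).
pose c := tri (b (Y 1)) (b (Y 2)) (b (Y 3)).
pose d := tri (b (X 1)) (b (Y 2)) (b (Y 3)).
pose u := c *: b (X 1) - d *: b (Y 1).
have triE : forall v w t, tri v w t = wedge (form u) (form (b (X 2))) (form (b (X 3))) v w t.
  apply: (alt3_lagrangian_eq b_std (alternating3_tri L)).
  - exact: alternating3_form_wedge.
  - by move=> i j v; rewrite xx /wedge !bE; ring.
  - case=> [|[|[|[|i]]]] [|[|[|[|j]]]] [|[|[|[|k]]]] //= _ _ _;
    first [rewrite xy'; [|done|done] | rewrite xy; [|done|done] | idtac];
    by rewrite /wedge !formE !bE //= /d; ring.
  case=> [|[|[|[|i]]]] [|[|[|[|j]]]] [|[|[|[|k]]]] //= _ _ _ _.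
  by rewrite /wedge !formE !bE //= /c; ring.
have [u0|u_n0] := eqVneq u 0.
  by left; apply/abelianP => v w t; rewrite triE u0 /wedge !form0l; ring.
right; apply: (@P6_31_intro _ _ u (b (X 2)) (b (X 3))) => //.
- have [z uz] : exists2 z, form u z != 0 & form (b (X 2)) z = 0 /\ form (b (X 3)) z = 0.
    have [c0|c_n0] := eqVneq c 0.
      exists (b (X 1)); last by rewrite !bE.
      have -> : form u (b (X 1)) = d by rewrite !formE !bE //=; ring.
      by apply: contra_neq u_n0 => d0; rewrite /u c0 d0 !scale0r subr0.
    exists (b (Y 1)); last by rewrite !bE.
    by have -> : form u (b (Y 1)) = c by rewrite !formE !bE //=; ring.
  case=> x2z x3z; apply: (@free_triangular _ _ _ [:: z; b (Y 2); b (Y 3)]).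
  by rewrite /= uz x2z x3z !bE //= !eqxx oner_neq0.
- by rewrite !formE !bE //=; ring.
- by rewrite !formE !bE //=; ring.
- by rewrite bE.
Qed.

Lemma nilpotent_dim8 : saa_nilpotent L -> \dim {:L} = 8%N -> classified8 L.
Proof.
move=> nilL dimL; have [b [b_std xx xy xy']] := @nilpotent_basisXY 3 nilL dimL.
have bE := (formXX b_std, formYY b_std, formXY b_std, formYX b_std).
pose formE := (formDl, formNl, formZl, formDr, formNr, formZr).
pose T123 := tri (b (Y 1)) (b (Y 2)) (b (Y 3)).
pose T124 := tri (b (Y 1)) (b (Y 2)) (b (Y 4)).
pose T134 := tri (b (Y 1)) (b (Y 3)) (b (Y 4)).
pose T234 := tri (b (Y 2)) (b (Y 3)) (b (Y 4)).
pose S23 := tri (b (X 1)) (b (Y 2)) (b (Y 3)).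
pose S24 := tri (b (X 1)) (b (Y 2)) (b (Y 4)).
pose S34 := tri (b (X 1)) (b (Y 3)) (b (Y 4)).
pose R34 := tri (b (X 2)) (b (Y 3)) (b (Y 4)).
apply: (@frame_classified (b (X 1)) (b (X 2)) (b (Y 1)) (b (Y 2)) (b (X 3)) (b (X 4))
  T134 (- S34) T234 (- R34) (- T123) S23 (- T124) S24 dimL).
  split; rewrite ?bE //; split; rewrite ?bE //.
    by exists (b (Y 3)), (b (Y 4)); rewrite !bE.
  by move=> x; rewrite !inE => /or4P[]/eqP->; rewrite !bE //= ?oppr0.
pose g v w t := wedge (form (T134 *: b (X 1) + (- S34) *: b (Y 1) + T234 *: b (X 2)
      + (- R34) *: b (Y 2))) (form (b (X 3))) (form (b (X 4))) v w t
    + wedge (form (b (X 2))) (form ((- T123) *: b (X 1) + S23 *: b (Y 1)))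
        (form (b (X 3))) v w t
    + wedge (form (b (X 2))) (form ((- T124) *: b (X 1) + S24 *: b (Y 1)))
        (form (b (X 4))) v w t.
apply: (alt3_lagrangian_eq b_std (alternating3_tri L) (g := g)).
- have W := alternating3_form_wedge.
  exact: alternating3_add (alternating3_add (W _ _ _ _ _) (W _ _ _ _ _)) (W _ _ _ _ _).
- by move=> i j v; rewrite xx /g /wedge !formE !(formXX b_std); ring.
- case=> [|[|[|[|[|i]]]]] [|[|[|[|[|j]]]]] [|[|[|[|[|k]]]]] //= _ _ _;
    first [rewrite xy'; [|done|done] | rewrite xy; [|done|done] | idtac];
    by rewrite /g /wedge !formE !bE //= /S23 /S24 /S34 /R34; ring.
case=> [|[|[|[|[|i]]]]] [|[|[|[|[|j]]]]] [|[|[|[|[|k]]]]] //= _ _ _ _.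
all: by rewrite /g /wedge !formE !bE //= /T123 /T124 /T134 /T234; ring.
Qed.

End Classification.

Section Summary.

Variable F : fieldType.

Lemma abelian_nilpotent (L : SAA F) : saa_abelian L -> saa_nilpotent L.
Proof. by exists 1%N. Qed.

Lemma abelian_has_presentation (L : SAA F) n : \dim {:L} = (2 * n)%N ->
  saa_abelian L -> has_presentation L ([::] : presentation F n).
Proof.
move=> dimL abL; have [b [b_std _ _]] := nilpotent_basis (abelian_nilpotent abL) dimL.
by exists b; split=> // u v w _; move/abelianP: abL => tri0; exact: tri0.
Qed.

Lemma abelian_algebras n :
  (exists L : SAA F,
     [/\ saa_dim L = (2 * n)%N, saa_abelian L & saa_nilpotent L]) /\
  (forall L M : SAA F, saa_dim L = (2 * n)%N -> saa_dim M = (2 * n)%N ->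
     saa_abelian L -> saa_abelian M -> saa_isomorphic L M).
Proof.
have coh : coherent ([::] : presentation F n) by [].
split=> [|L M dimL dimM abL abM]; last first.
  by apply: (saa_isomorphic_of_presentation coh); exact: abelian_has_presentation.
have [b [b_std triE]] := (has_presentationP _ coh).1 (model_has_presentation coh).
have abL : saa_abelian (model_saa ([::] : presentation F n)).
  by apply/abelianP => u v w; rewrite triE /presentation_form big_nil.
exists (model_saa ([::] : presentation F n)); split=> //.
  exact: dim_standard b_std.
exact: abelian_nilpotent.
Qed.

Lemma describes_P6_31 : describes_nonabelian_nilpotent (P6_31 F).
Proof.
apply: (@describes_weighted _ _ _ _ 2 (Y 1, Y 2, Y 3, 1) (coherent_P6_31 F)
  (weighted_P6_31 F)); rewrite ?mem_head ?oner_neq0 // => k.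
exact: weights_lt.
Qed.

Lemma describes_P8_51 : describes_nonabelian_nilpotent (P8_51 F).
Proof.
apply: (@describes_weighted _ _ _ _ 2 (Y 1, Y 2, Y 3, 1) (coherent_P8_51 F)
  (weighted_P8_51 F)); rewrite ?mem_head ?oner_neq0 // => k.
exact: weights_lt.
Qed.

Lemma describes_P8_32 : describes_nonabelian_nilpotent (P8_32 F).
Proof.
apply: (@describes_weighted _ _ _ _ 3 (Y 1, Y 2, Y 3, 1) (coherent_P8_32 F)
  (weighted_P8_32 F)); rewrite ?mem_head ?oner_neq0 // => k.
exact: weights_lt.
Qed.

Lemma describes_P8_23 (r : F) : describes_nonabelian_nilpotent (P8_23 r).
Proof.
apply: (@describes_weighted _ _ _ _ 5 (Y 1, Y 2, Y 3, 1) (coherent_P8_23 r)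
  (weighted_P8_23 r)); rewrite ?inE ?eqxx ?orbT ?oner_neq0 // => k.
exact: weights_lt.
Qed.

Lemma P8_exactly_one (L : SAA F) : classified8 L ->
  saa_abelian L \/
  exactly_one_of3 (has_presentation L (P8_51 F)) (has_presentation L (P8_32 F))
                  (exists2 r : F, r != 0 & has_presentation L (P8_23 r)).
Proof.
have pow34 : saa_pow L 3 = 0%VS -> saa_pow L 4 = 0%VS.
  move=> L3; apply/eqP; rewrite -subv0 [saa_pow L 4]/(saa_prodv (saa_pow L 3) fullv) L3.
  by apply/saa_prodvP => u v; rewrite memv0 => /eqP-> _; rewrite linear0l memv0.
have n51_32 : has_presentation L (P8_51 F) -> ~ has_presentation L (P8_32 F).
  by move=> /saa_pow3_P8_51 L3 /saa_pow3_P8_32; rewrite L3 eqxx.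
have n51_23 : has_presentation L (P8_51 F) ->
    ~ exists2 r : F, r != 0 & has_presentation L (P8_23 r).
  by move=> /saa_pow3_P8_51/pow34 L4 [r r_n0 /(saa_pow4_P8_23 r_n0)]; rewrite L4 eqxx.
have n32_23 : has_presentation L (P8_32 F) ->
    ~ exists2 r : F, r != 0 & has_presentation L (P8_23 r).
  by move=> /saa_pow4_P8_32 L4 [r r_n0 /(saa_pow4_P8_23 r_n0)]; rewrite L4 eqxx.
case=> [abL|P51|P32|P23]; [by left | right..].
- by apply: Or31; split=> //; [exact: n51_32 | exact: n51_23].
- by apply: Or32; split=> //; [move=> /n51_32 | exact: n32_23].
- by apply: Or33; split=> //; [move=> /n51_23 | move=> /n32_23].
Qed.

Lemma P8_23_isomorphic (r s : F) (L M : SAA F) : r != 0 -> s != 0 ->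
  has_presentation L (P8_23 r) -> has_presentation M (P8_23 s) ->
  (saa_isomorphic L M <-> exists2 a : F, a != 0 & s / r = a ^+ 3).
Proof.
move=> r_n0 s_n0 Lr Ms; split=> [LM|[a a_n0 sr]].
  exact: P8_23_cube r_n0 s_n0 (has_presentation_iso LM Lr) Ms.
apply: (saa_isomorphic_of_presentation (coherent_P8_23 s)) Ms.
have -> : s = r * a ^+ 3 by rewrite -sr mulrCA divff ?mulr1.
exact: P8_23_scale.
Qed.

End Summary.

Theorem mainTheorem6 (F : fieldType) :
  (* there is exactly one abelian algebra in each dimension, and it is nilpotent *)
  (forall n : nat, (1 <= n <= 4)%N ->
     (exists L : SAA F,
        [/\ saa_dim L = (2 * n)%N, saa_abelian L & saa_nilpotent L]) /\
     (forall L M : SAA F, saa_dim L = (2 * n)%N -> saa_dim M = (2 * n)%N ->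
        saa_abelian L -> saa_abelian M -> saa_isomorphic L M)) /\
  (* (1) *)
  (forall L : SAA F, saa_dim L = 2%N \/ saa_dim L = 4%N ->
     saa_nilpotent L -> saa_abelian L) /\
  (* (2) *)
  (describes_nonabelian_nilpotent (P6_31 F) /\
   forall L : SAA F, saa_dim L = 6%N -> saa_nilpotent L ->
     saa_abelian L \/ has_presentation L (P6_31 F)) /\
  (* (3) *)
  (describes_nonabelian_nilpotent (P8_51 F) /\
   describes_nonabelian_nilpotent (P8_32 F) /\
   (forall r : F, r != 0 -> describes_nonabelian_nilpotent (P8_23 r)) /\
   (forall L : SAA F, saa_dim L = 8%N -> saa_nilpotent L ->
      saa_abelian L \/
      exactly_one_of3 (has_presentation L (P8_51 F))
                      (has_presentation L (P8_32 F))
                      (exists2 r : F, r != 0 & has_presentation L (P8_23 r))) /\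
   (forall r s : F, r != 0 -> s != 0 ->
      forall L M : SAA F,
        has_presentation L (P8_23 r) -> has_presentation M (P8_23 s) ->
        (saa_isomorphic L M <-> exists2 a : F, a != 0 & s / r = a ^+ 3))).
Proof.
split; first by move=> n _; exact: abelian_algebras.
split.
  move=> L [dimL|dimL] nilL.
    by apply: (@nilpotent_abelian _ _ 0).
  by apply: (@nilpotent_abelian _ _ 1).
split.
  split; first exact: describes_P6_31.
  by move=> L dimL nilL; exact: nilpotent_dim6.
split; first exact: describes_P8_51.
split; first exact: describes_P8_32.
split; first by move=> r _; exact: describes_P8_23.
split; first by move=> L dimL nilL; apply: P8_exactly_one; exact: nilpotent_dim8.
by move=> r s r_n0 s_n0 L M; exact: P8_23_isomorphic.
Qed.
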